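(* The hypersurface $\tilde{\mathcal{W}}=\{f\in\mathcal{F}^+\mid r(f)=1\}$ of $\mathcal{F}^+$ has the dually flat structure induced (via the identification $\bar{T}|_{\tilde{\mathcal{W}}}:\tilde{\mathcal{W}}\to\tilde{M}$) by the potential function $\tilde{\varphi}:=\bar{\varphi}|_{\tilde{M}}$ on $\tilde{M}$. The restriction of this dually flat structure to $\mathcal{W}\subset\tilde{\mathcal{W}}$ is the dually flat structure $(g,\nabla^{(e)},\nabla^{(m)})$ of Nagaoka on $\mathcal{W}$. Moreover, for every standard convex function $F$, the $F$-divergence on $\tilde{\mathcal{W}}$ is written as $$\mathcal{D}_F(f,g)=\sum_{(x,y)\in\mathcal{E}}\mu_f(x)f(x,y)\,F\!\left(\frac{g(x,y)}{f(x,y)}\right),\qquad f,g\in\tilde{\mathcal{W}}.$$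
   Context: Let $\mathcal{X}=\{0,1,\dots,d\}$ with $d\ge 1$ and $\mathcal{E}\subset\mathcal{X}\times\mathcal{X}$. Assume $\mathcal{E}$ is strongly connected: for any $x,y\in\mathcal{X}$ there exist $N\ge 2$ and $(x_1,x_2),\dots,(x_{N-1},x_N)\in\mathcal{E}$ with $x_1=x$, $x_N=y$. Let $\mathcal{F}$ be the set of real functions on $\mathcal{E}$, $\mathcal{F}^+$ the set of positive functions on $\mathcal{E}$, and $\mathcal{W}=\{w\in\mathcal{F}^+\mid\sum_{y:(x,y)\in\mathcal{E}}w(x,y)=1\ \text{for all }x\in\mathcal{X}\}$ the space of transition probabilities. For $f\in\mathcal{F}^+$ let $A(f)=[a_{ij}(f)]_{0\le i,j\le d}$ with $a_{ij}(f)=f(i,j)$ if $(i,j)\in\mathcal{E}$ and $0$ otherwise; it is nonnegative and irreducible. Let $r(f)>0$ be its Perron-Frobenius root (the simple real eigenvalue with $r(f)\ge|\lambda|$ for every eigenvalue $\lambda$), and $\mu_f=(\mu_f(0),\dots,\mu_f(d))^T$ the unique left eigenvector, $\mu_f^TA(f)=r(f)\mu_f^T$, with all $\mu_f(x)>0$ and $\sum_x\mu_f(x)=1$. For $w\in\mathcal{W}$ one has $r(w)=1$; thus $\mathcal{W}\subset\tilde{\mathcal{W}}$. A standard convex function is a strictly convex $F:(0,\infty)\to\mathbb{R}$ with $F(1)=F'(1)=0$, $F''(1)=1$. The $F$-divergence on $\mathcal{F}^+$ is $\mathcal{D}_F(f,g)=\sum_{(x,y)\in\mathcal{E}}\mu_f(x)f(x,y)F\!\left(\frac{g(x,y)/r(g)}{f(x,y)/r(f)}\right)$;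 on $\tilde{\mathcal{W}}$ it is the restriction to $\tilde{\mathcal{W}}\times\tilde{\mathcal{W}}$. Let $\overline{M}=\{\eta=(\eta_{xy})_{(x,y)\in\mathcal{E}}\mid\eta_{xy}>0\}\subset\mathbb{R}^{|\mathcal{E}|}$; for $\eta\in\overline{M}$ put $r(\eta)=\sum_{(x,y)\in\mathcal{E}}\eta_{xy}$, $\eta^x=\sum_{k:(k,x)\in\mathcal{E}}\eta_{kx}$, $\eta_x=\sum_{k:(x,k)\in\mathcal{E}}\eta_{xk}$. Let $\bar{T}:\mathcal{F}^+\to\overline{M}$, $f\mapsto(\mu_f(x)f(x,y))_{(x,y)\in\mathcal{E}}$, a diffeomorphism with $r(\bar{T}(f))=r(f)$. Let $\bar{\varphi}(\eta)=\sum_{(x,y)\in\mathcal{E}}\eta_{xy}\log\eta_{xy}-\sum_{x\in\mathcal{X}}\eta_x\log\eta^x$ on $\overline{M}$, and $\tilde{M}=\{\eta\in\overline{M}\mid r(\eta)=1\}$, so that $\bar{T}$ maps $\tilde{\mathcal{W}}$ diffeomorphically onto $\tilde{M}$. Let $M=\{\eta\in\tilde{M}\mid\eta_x=\eta^x\ \text{for all }x\in\mathcal{X}\}$; $\bar{T}$ maps $\mathcal{W}$ diffeomorphically onto $M$, an affine slice of $\tilde{M}$. A dually flat structure on a manifold is a triple $(h,\nabla,\nabla^* )$ of a Riemannian metric $h$ and flat torsion-free affine connections $\nabla,\nabla^*$ with $Xh(Y,Z)=h(\nabla_XY,Z)+h(Y,\nabla^*_XZ)$ for all vector fields. The dually flat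 structure induced by a potential function (a smooth function with positive definite Hessian matrix) $\tilde{\varphi}$ on the open subset $\tilde{M}$ of an affine hyperplane consists of: the metric $h$ given by the Hessian matrix of $\tilde{\varphi}$ in affine coordinates of $\tilde{M}$, the flat connection whose affine coordinates are the affine coordinates of $\tilde{M}$, and the dual of this connection with respect to $h$. The restriction of such a structure to a submanifold consists of the induced metric and the two connections induced by $h$-orthogonal projection onto the tangent spaces of the submanifold. Nagaoka's dually flat structure $(g,\nabla^{(e)},\nabla^{(m)})$ on $\mathcal{W}$: for $w\in\mathcal{W}$ put $p_w^{(2)}(x,y)=\mu_w(x)w(x,y)$. Let $\mathcal{F}^A=\{f\in\mathcal{F}\mid f(x,y)=\kappa(y)-\kappa(x),\ \kappa:\mathcal{X}\to\mathbb{R}\}$ and choose $F_1,\dots,F_k\in\mathcal{F}$ whose classes form a basis of $\mathcal{F}/(\mathcal{F}^A\oplus\mathbb{R})$ ($\mathbb{R}$ = constant functions). Then $\mathcal{W}$ is parameterized diffeomorphically by $\theta\in\mathbb{R}^k$ (natural parameters) via $\log w_\theta(x,y)=\sum_{i=1}^k\theta_iF_i(x,y)+K_\theta(y)-K_\theta(x)-\psi(\theta)$ for suitable functions $K_\theta:\mathcal{X}\to\mathbb{R}$ and $\psi:\mathbb{R}^k\to\mathbb{R}$. With $\partial_i=\partial/\partial\theta_i$, $$g(\partial_i,\partial_j)=\sum_{(x,y)\in\mathcal{E}}p^{(2)}_{w_\theta}(x,y)\,\partial_i\log w_\theta(x,y)\,\partial_j\log w_\theta(x,y),$$ $$g(\nabla^{(e)}_{\partial_i}\partial_j,\partial_k)=\sum_{(x,y)\in\mathcal{E}}\partial_i\partial_j\log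 w_\theta(x,y)\,\partial_kp^{(2)}_{w_\theta}(x,y),$$ $$g(\nabla^{(m)}_{\partial_i}\partial_j,\partial_k)=\sum_{(x,y)\in\mathcal{E}}\partial_i\partial_jp^{(2)}_{w_\theta}(x,y)\,\partial_k\log w_\theta(x,y).$$ Under restriction, the connection on $\tilde{\mathcal{W}}$ whose affine coordinates are those of $\tilde{M}$ corresponds to $\nabla^{(m)}$, and its dual corresponds to $\nabla^{(e)}$. *)

(* Defs.v *)
From HB Require Import structures.
From mathcomp Require Import all_boot all_order all_algebra.
From mathcomp Require Import complex.
From mathcomp Require Import all_classical all_reals all_analysis.

Set Implicit Arguments.
Unset Strict Implicit.
Unset Printing Implicit Defensive.

Import Order.TTheory GRing.Theory Num.Theory.
Import numFieldNormedType.Exports.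

Local Open Scope classical_set_scope.
Local Open Scope ring_scope.

(* A manifold here is a set [pts] with an injective global chart [coord] whose
   image is a relatively open subset of an affine subspace with direction
   [dirs] of a normed space [U] (not necessarily the whole of [U], so that no
   basis of [dirs] has to be chosen).  A tangent vector at [p] is represented
   by its image under the differential of the chart, that is by an element of
   [dirs]; hence a vector field is a map from points to [dirs].  Functions and
   fields are total, and only their values on [pts] matter.  Since only
   derivatives in directions of [dirs] are taken, these derivatives depend
   only on the values on the relatively open set. *)

Record chart_manifold (R : realType) (T : Type) (U : normedModType R) :=
  ChartManifold { pts : set T; coord : T -> U; dirs : set U }.

Section Manifolds.
Variables (R : realType).

Fixpoint iter_derive (U Z : normedModType R) (f : U -> Z) (vs : seq U) : U -> Z :=
  if vs is v :: vs' then 'D_v (iter_derive f vs') else f.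

(* C^oo: all iterated derivatives in the directions [V] exist and are
   continuous on [A]. *)
Definition smooth_on (U Z : normedModType R) (A V : set U) (f : U -> Z) : Prop :=
  forall vs : seq U, (forall v, v \in vs -> V v) ->
    {within A, continuous (iter_derive f vs)} /\
    (forall u v, A u -> V v -> derivable (iter_derive f vs) u v).

Definition hessian (U : normedModType R) (phi : U -> R) (u v1 v2 : U) : R :=
  'D_v1 ('D_v2 phi) u.

Definition potential_on (U : normedModType R) (A V : set U) (phi : U -> R) : Prop :=
  smooth_on A V phi /\
  (forall u v, A u -> V v -> v != 0 -> 0 < hessian phi u v v).

Variables (T : pointedType) (U : normedModType R).
Implicit Types (m : chart_manifold T U) (X Y : T -> U).

Definition coord_image m : set U := coord m @` pts m.

Definition wf_manifold m : Prop :=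
  [/\ {in pts m &, injective (coord m)},
      dirs m 0 /\ (forall (a : R) u v, dirs m u -> dirs m v -> dirs m (a *: u + v)),
      (forall u v, coord_image m u -> coord_image m v -> dirs m (u - v)) &
      (forall u, coord_image m u ->
         \forall v \near (0 : U), dirs m v -> coord_image m (u + v))].

Definition in_coord (Z : Type) m (f : T -> Z) : U -> Z := f \o pinv (pts m) (coord m).

Definition smooth (Z : normedModType R) m (f : T -> Z) : Prop :=
  smooth_on (coord_image m) (dirs m) (in_coord m f).

Definition vector_field m X : Prop :=
  smooth m X /\ (forall p, pts m p -> dirs m (X p)).

Definition deriv_along (Z : normedModType R) m X (f : T -> Z) (p : T) : Z :=
  'D_(X p) (in_coord m f) (coord m p).

Definition lie_bracket m X Y (p : T) : U :=
  deriv_along m X Y p - deriv_along m Y X p.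

Definition agree m (Z : Type) (f g : T -> Z) : Prop := forall p, pts m p -> f p = g p.

Definition affine_connection m (nabla : (T -> U) -> (T -> U) -> (T -> U)) : Prop :=
  [/\ (forall X Y, vector_field m X -> vector_field m Y ->
         vector_field m (nabla X Y)),
      (forall X X' Y Y', vector_field m X -> vector_field m X' ->
         vector_field m Y -> vector_field m Y' ->
         agree m X X' -> agree m Y Y' -> agree m (nabla X Y) (nabla X' Y')),
      (forall (f : T -> R) X X' Y, smooth m f ->
         vector_field m X -> vector_field m X' -> vector_field m Y ->
         agree m (nabla (fun p => f p *: X p + X' p) Y)
                 (fun p => f p *: nabla X Y p + nabla X' Y p)) &
      (forall (f : T -> R) X Y Y', smooth m f ->
         vector_field m X -> vector_field m Y -> vector_field m Y' ->
         agree m (nabla X (fun p => f p *: Y p + Y' p))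
                 (fun p => deriv_along m X f p *: Y p
                           + f p *: nabla X Y p + nabla X Y' p))].

Definition torsion_free m (nabla : (T -> U) -> (T -> U) -> (T -> U)) : Prop :=
  forall X Y, vector_field m X -> vector_field m Y ->
    agree m (fun p => nabla X Y p - nabla Y X p) (lie_bracket m X Y).

Definition curvature_free m (nabla : (T -> U) -> (T -> U) -> (T -> U)) : Prop :=
  forall X Y Z, vector_field m X -> vector_field m Y -> vector_field m Z ->
    agree m (fun p => nabla X (nabla Y Z) p - nabla Y (nabla X Z) p)
            (nabla (lie_bracket m X Y) Z).

Definition riemannian_metric m (h : T -> U -> U -> R) : Prop :=
  [/\ (forall p (a : R) u v z, pts m p -> dirs m u -> dirs m v -> dirs m z ->
         h p (a *: u + v) z = a * h p u z + h p v z),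
      (forall p u v, pts m p -> dirs m u -> dirs m v -> h p u v = h p v u),
      (forall p u, pts m p -> dirs m u -> u != 0 -> 0 < h p u u) &
      (forall X Y, vector_field m X -> vector_field m Y ->
         smooth m (fun p => h p (X p) (Y p)))].

Definition dual_connections m (h : T -> U -> U -> R)
    (nabla nabla' : (T -> U) -> (T -> U) -> (T -> U)) : Prop :=
  forall X Y Z, vector_field m X -> vector_field m Y -> vector_field m Z ->
    agree m (deriv_along m X (fun p => h p (Y p) (Z p)))
            (fun p => h p (nabla X Y p) (Z p) + h p (Y p) (nabla' X Z p)).

Record dual_structure := DualStructure {
  metric : T -> U -> U -> R;
  conn : (T -> U) -> (T -> U) -> (T -> U);
  dual_conn : (T -> U) -> (T -> U) -> (T -> U) }.

Implicit Type s : dual_structure.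

Definition dually_flat m s : Prop :=
  [/\ wf_manifold m,
      riemannian_metric m (metric s),
      [/\ affine_connection m (conn s), torsion_free m (conn s)
        & curvature_free m (conn s)],
      [/\ affine_connection m (dual_conn s), torsion_free m (dual_conn s)
        & curvature_free m (dual_conn s)] &
      dual_connections m (metric s) (conn s) (dual_conn s)].

(* The structure induced on [m] by the potential [phi] on [coord_image m].  The
   connection whose affine coordinates are those of the chart differentiates
   the components of a field; [dual_conn s] is then determined on vector fields
   by non-degeneracy of the metric. *)
Definition induced_by_potential m (phi : U -> R) s : Prop :=
  [/\ potential_on (coord_image m) (dirs m) phi,
      (forall p u v, pts m p -> dirs m u -> dirs m v ->
         metric s p u v = hessian phi (coord m p) u v),
      (forall X Y, vector_field m X -> vector_field m Y ->
         agree m (conn s X Y) (deriv_along m X Y)),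
      affine_connection m (dual_conn s) &
      dual_connections m (metric s) (conn s) (dual_conn s)].

Definition orthogonal_projection (h : U -> U -> R) (V : set U) (u v : U) : Prop :=
  V v /\ (forall z, V z -> h (u - v) z = 0).

Definition submanifold m' m : Prop :=
  [/\ pts m' `<=` pts m, dirs m' `<=` dirs m & agree m' (coord m') (coord m)].

(* [nabla'] is obtained from [nabla] by projecting onto the tangent spaces of
   [m'].  A vector field on [m'] is differentiated through extensions to [m];
   constant fields have extensions and span the tangent spaces, so this
   determines the affine connection [nabla']. *)
Definition projected_connection m m' (h : T -> U -> U -> R)
    (nabla nabla' : (T -> U) -> (T -> U) -> (T -> U)) : Prop :=
  affine_connection m' nabla' /\
  (forall X' Y' X Y, vector_field m' X' -> vector_field m' Y' ->
     vector_field m X -> vector_field m Y -> agree m' X' X -> agree m' Y' Y ->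
     forall p, pts m' p ->
       orthogonal_projection (h p) (dirs m') (nabla X Y p) (nabla' X' Y' p)).

Definition restriction m m' s s' : Prop :=
  [/\ submanifold m' m,
      (forall p u v, pts m' p -> dirs m' u -> dirs m' v ->
         metric s' p u v = metric s p u v),
      projected_connection m m' (metric s) (conn s) (conn s') &
      projected_connection m m' (metric s) (dual_conn s) (dual_conn s')].

Definition global_parametrization (U1 : normedModType R) m (w : U1 -> T) : Prop :=
  [/\ set_bij setT (pts m) w,
      smooth_on setT setT (coord m \o w) &
      smooth m (pinv setT w)].

End Manifolds.

(* A real function on the edge set [E] is encoded by the matrix having its
   values at the edges and zero elsewhere; thus [A(f)] is [f] itself. *)

Section MarkovChains.
Variables (R : realType) (d : nat) (E : {set 'I_d.+1 * 'I_d.+1}).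

Local Notation mx := 'M[R]_d.+1.

Definition strongly_connected : Prop :=
  forall x y : 'I_d.+1, exists2 s : seq 'I_d.+1,
    s != [::] & path (fun a b => (a, b) \in E) x s /\ last x s = y.

Definition edge_fun : set mx :=
  [set f : mx | forall x y, (x, y) \notin E -> f x y = 0].

Definition pos_fun : set mx :=
  [set f : mx | edge_fun f /\ forall x y, (x, y) \in E -> 0 < f x y].

Definition Wset : set mx :=
  [set w : mx | pos_fun w /\ forall x, \sum_(y | (x, y) \in E) w x y = 1].

Definition is_perron_root (A : mx) (r : R) : Prop :=
  [/\ 0 < r, mup r (char_poly A) = 1%N &
      forall z : R[i], eigenvalue (map_mx (real_complex R) A) z ->
        `|z| <= real_complex R r].

Definition perron_root (A : mx) : R := get [set r | is_perron_root A r].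

Definition mu (A : mx) : 'rV[R]_d.+1 :=
  get [set v : 'rV[R]_d.+1 | [/\ v *m A = perron_root A *: v,
                               forall x, 0 < v ord0 x & \sum_x v ord0 x = 1]].

Definition Wtilde : set mx := [set f : mx | pos_fun f /\ perron_root f = 1].

Definition Tbar (f : mx) : mx := \matrix_(x, y) (mu f ord0 x * f x y).

Definition out_sum (eta : mx) (x : 'I_d.+1) : R := \sum_(k | (x, k) \in E) eta x k.
Definition in_sum (eta : mx) (x : 'I_d.+1) : R := \sum_(k | (k, x) \in E) eta k x.

Definition Mtilde : set mx :=
  [set eta : mx | pos_fun eta /\ \sum_(e in E) eta e.1 e.2 = 1].

Definition Mset : set mx :=
  [set eta : mx | Mtilde eta /\ forall x, out_sum eta x = in_sum eta x].

Definition Mtilde_dirs : set mx :=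
  [set v : mx | edge_fun v /\ \sum_(e in E) v e.1 e.2 = 0].

Definition Mset_dirs : set mx :=
  [set v : mx | Mtilde_dirs v /\ forall x, out_sum v x = in_sum v x].

Definition phibar (eta : mx) : R :=
  \sum_(e in E) eta e.1 e.2 * ln (eta e.1 e.2)
  - \sum_x out_sum eta x * ln (in_sum eta x).

Definition Wtilde_manifold : chart_manifold mx mx :=
  ChartManifold Wtilde Tbar Mtilde_dirs.

Definition W_manifold : chart_manifold mx mx :=
  ChartManifold Wset Tbar Mset_dirs.

Definition pair_dist (w : mx) (x y : 'I_d.+1) : R := mu w ord0 x * w x y.

(* On the edges, [f] is the sum of an element of F^A and a constant. *)
Definition trivial_fun (f : mx) : Prop :=
  exists (kappa : 'I_d.+1 -> R) (c : R),
    forall x y, (x, y) \in E -> f x y = kappa y - kappa x + c.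

Definition quotient_basis (k : nat) (F : 'I_k -> mx) : Prop :=
  [/\ forall i, edge_fun (F i),
      (forall a : 'I_k -> R, trivial_fun (\sum_i a i *: F i) -> forall i, a i = 0) &
      (forall f, edge_fun f ->
         exists a : 'I_k -> R, trivial_fun (f - \sum_i a i *: F i))].

Definition natural_parametrization (k : nat) (F : 'I_k -> mx) (w : 'rV[R]_k -> mx) :
    Prop :=
  global_parametrization W_manifold w /\
  exists (K : 'rV[R]_k -> 'I_d.+1 -> R) (psi : 'rV[R]_k -> R),
    forall theta x y, (x, y) \in E ->
      ln (w theta x y) =
        \sum_i theta ord0 i * F i x y + K theta y - K theta x - psi theta.

Definition partial (Z : normedModType R) (k : nat) (i : 'I_k) (f : 'rV[R]_k -> Z) :
    'rV[R]_k -> Z :=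
  'D_(delta_mx ord0 i) f.

(* The coordinate field of the [i]-th natural parameter on [Wset], in the
   chart [Tbar]. *)
Definition natural_field (k : nat) (w : 'rV[R]_k -> mx) (i : 'I_k) : mx -> mx :=
  fun p => partial i (Tbar \o w) (pinv setT w p).

(* [metric s], [dual_conn s] and [conn s] are Nagaoka's g, nabla^(e), nabla^(m). *)
Definition is_nagaoka (k : nat) (w : 'rV[R]_k -> mx) (s : dual_structure mx mx) :
    Prop :=
  let D := natural_field w in
  let log_w x y theta := ln (w theta x y) in
  let p2 x y theta := pair_dist (w theta) x y in
  [/\ (forall theta i j,
         metric s (w theta) (D i (w theta)) (D j (w theta)) =
         \sum_(e in E) p2 e.1 e.2 theta * partial i (log_w e.1 e.2) theta
                         * partial j (log_w e.1 e.2) theta),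
      (forall theta i j l,
         metric s (w theta) (dual_conn s (D i) (D j) (w theta)) (D l (w theta)) =
         \sum_(e in E) partial i (partial j (log_w e.1 e.2)) theta
                         * partial l (p2 e.1 e.2) theta) &
      (forall theta i j l,
         metric s (w theta) (conn s (D i) (D j) (w theta)) (D l (w theta)) =
         \sum_(e in E) partial i (partial j (p2 e.1 e.2)) theta
                         * partial l (log_w e.1 e.2) theta)].

Definition standard_convex (F : R -> R) : Prop :=
  [/\ (forall s t a : R, 0 < s -> 0 < t -> s != t -> 0 < a < 1 ->
         F (a * s + (1 - a) * t) < a * F s + (1 - a) * F t),
      F 1 = 0,
      \forall t \near (1 : R), derivable F t 1,
      is_derive (1 : R) (1 : R) F 0 &
      is_derive (1 : R) (1 : R) (derive1 F) 1].

Definition F_divergence (F : R -> R) (f g : mx) : R :=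
  \sum_(e in E) mu f ord0 e.1 * f e.1 e.2 *
    F ((g e.1 e.2 / perron_root g) / (f e.1 e.2 / perron_root f)).

End MarkovChains.

(* Main.v *)
(* Perron-Frobenius theory makes [Tbar] a bijection, with inverse
   [eta |-> eta_xy / eta^x], so that in this chart everything becomes a statement
   about functions of [eta].  At [eta] in [Mtilde] the Hessian of [phibar] is
     sum_xy eta_xy (u_xy / eta_xy - u^x / eta^x) (v_xy / eta_xy - v^x / eta^x).
   If it vanishes at [u = v], then [(u^x)] is a left eigenvector of
   [eta_xy / eta^x] for the eigenvalue 1, hence [u] is a multiple of [eta]; so the
   Hessian is positive definite on directions of total mass zero.

   For any potential [phi], the connection dual to the flat one is determined by
   [h(y, nabla*_X Z) = X h(y, Z)] for constant [y].  Since [h(y, Z)] is the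
   derivative of [d_y phi] along [Z], the torsion and curvature of [nabla*] vanish
   because [X Y f - Y X f = [X, Y] f].  Along an affine slice this equation only
   involves the restriction of [phi], so restricting the structure amounts to
   restricting the potential.

   Finally [log w_xy = log eta_xy - log eta^x] on [Wset], whose derivative along
   [u] is [u_xy / eta_xy - u^x / eta^x]: the Hessian structure is Nagaoka's. *)
Require Import Defs.
From HB Require Import structures.
From mathcomp Require Import all_boot all_order all_algebra.
From mathcomp Require Import complex.
From mathcomp Require Import all_classical all_reals all_analysis.
From mathcomp Require Import ring.

Set Implicit Arguments.
Unset Strict Implicit.
Unset Printing Implicit Defensive.

Import Order.TTheory GRing.Theory Num.Theory.
Import numFieldNormedType.Exports.

Local Open Scope classical_set_scope.
Local Open Scope ring_scope.

(** * Perron-Frobenius theory *)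

(** Both [perron_root] and [mu] are values of [get], and [is_perron_root] asks for a simple root of
    the characteristic polynomial that dominates all complex eigenvalues, so existence and
    uniqueness must be available before anything can be computed with them. One positive left
    eigenvector settles both clauses, by comparing other vectors with it coordinatewise.

    On the differential side the obstacle is that a function is controlled only on a relatively open
    subset of an affine subspace and only in its directions; elsewhere its values are arbitrary and
    no ambient differential is at hand. Linearity of ['D_v f] in [v], the chain rule and the
    symmetry of second derivatives are therefore drawn from the continuity of iterated directional
    derivatives, by the mean value theorem. Smoothness comes from classes of functions closed under
    directional derivatives.

    The dual connection is given implicitly by a non-degenerate pairing; a basis of the direction
    space makes it explicit through the inverse Gram matrix, whose entries are smooth by Cramer's
    rule. *)

Lemma cvgr_sum (R : numFieldType) (V : normedModType R) (T : Type)
    (F : set_system T) {FF : Filter F} (I : Type) (r : seq I) (P : pred I)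
    (f : I -> T -> V) (a : I -> V) :
  (forall i, P i -> f i x @[x --> F] --> a i) ->
  \sum_(i <- r | P i) f i x @[x --> F] --> \sum_(i <- r | P i) a i.
Proof. by apply: cvg_big => //; exact: add_continuous. Qed.

Section PerronFrobenius.
Variables (R : realType) (d : nat) (E : {set 'I_d.+1 * 'I_d.+1}).
Hypothesis Econ : strongly_connected E.
Implicit Types (A f : 'M[R]_d.+1) (u v x : 'rV[R]_d.+1).

Lemma pos_fun_ge0 A : pos_fun E A -> forall i j, 0 <= A i j.
Proof.
move=> [A0 Agt0] i j; have [/Agt0/ltW//|/A0 ->//] := boolP ((i, j) \in E).
Qed.

(** Vanishing travels backwards along edges, and from every vertex some path leads to [j]. *)
Lemma connected_zero x :
  (forall i j, (i, j) \in E -> x ord0 j = 0 -> x ord0 i = 0) ->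
  forall j, x ord0 j = 0 -> x = 0.
Proof.
move=> xE j xj; apply/rowP => i; rewrite mxE.
have [s _ [+ sj]] := Econ i j.
elim: s i sj => [|k s IH] i /= ; first by move=> ->.
by move=> sj /andP[ik /IH] /(_ sj) /(xE _ _ ik).
Qed.

(** Coordinate [j] of [v *m A] is a sum of nonnegative terms; if it is zero, [v] vanishes at every
    predecessor of [j]. *)
Lemma eigen_zero A v (r : R) : pos_fun E A -> (forall i, 0 <= v ord0 i) ->
  v *m A = r *: v -> forall j, v ord0 j = 0 -> v = 0.
Proof.
move=> Apos v0 vA; apply: connected_zero => i j ij vj.
have /eqP := congr1 (fun w : 'rV_d.+1 => w ord0 j) vA.
rewrite !mxE vj mulr0 psumr_eq0 => [|k _]; last first.
  by rewrite mulr_ge0 ?v0 ?(pos_fun_ge0 Apos).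
move=> /allP/(_ i); rewrite mem_index_enum => /(_ isT)/implyP/(_ isT).
by rewrite mulf_eq0 => /orP[/eqP//|]; rewrite gt_eqF//; apply Apos.2.
Qed.

(** Let [t] be the largest ratio y_i / v_i. Then t v - y is nonnegative with a zero coordinate, and
    reading its image under [A] at that coordinate forces b <= 0; the same for [- x] gives the other
    sign. Once the coefficient is zero, t v - y is a nonnegative eigenvector with a zero coordinate,
    hence zero. That [c] vanishes means that [r] carries no Jordan block, which is what algebraic
    simplicity needs. *)
Lemma generalized_eigen A v x (r c : R) : pos_fun E A ->
  (forall i, 0 < v ord0 i) -> v *m A = r *: v -> x *m A = r *: x + c *: v ->
  c = 0 /\ exists t, x = t *: v.
Proof.
move=> Apos v0 vA.
have key y b : y *m A = r *: y + b *: v -> b <= 0 /\ (b = 0 -> exists t, y = t *: v).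
  move=> yA.
  have /= [i0 _ i0max] := @arg_maxP _ _ _ ord0 xpredT
    (fun i => y ord0 i / v ord0 i) isT.
  set t := y ord0 i0 / v ord0 i0 in i0max.
  pose z := t *: v - y.
  have z0 i : 0 <= z ord0 i.
    by rewrite !mxE subr_ge0 -ler_pdivrMr; [exact: i0max|].
  have zi0 : z ord0 i0 = 0 by rewrite !mxE divfK ?subrr// gt_eqF.
  have zA : z *m A = r *: z - b *: v.
    rewrite mulmxBl -scalemxAl vA yA scalerBr !scalerA mulrC opprD addrA//.
  split=> [|b0].
    have := congr1 (fun w : 'rV_d.+1 => w ord0 i0) zA.
    rewrite [RHS]mxE [X in X + _]mxE zi0 mulr0 add0r !mxE => zAi0.
    have : 0 <= - (b * v ord0 i0).
      by rewrite -zAi0 sumr_ge0// => i _; rewrite mulr_ge0 ?(pos_fun_ge0 Apos).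
    by rewrite oppr_ge0 pmulr_lle0.
  exists t; apply/eqP; rewrite eq_sym -subr_eq0; apply/eqP.
  by apply: (eigen_zero (r := r) Apos z0 _ zi0); rewrite zA b0 scale0r subr0.
move=> xA; have [c0 xt] := key _ _ xA.
have [|nc0 _] := key (- x) (- c).
  by rewrite mulNmx xA opprD scalerN scaleNr.
have cE : c = 0 by apply/eqP; rewrite eq_le c0 -oppr_le0.
by split; [|exact: xt].
Qed.

Lemma left_eigen_unique A u v (r : R) : pos_fun E A ->
  (forall i, 0 < v ord0 i) -> v *m A = r *: v -> u *m A = r *: u ->
  exists t, u = t *: v.
Proof.
move=> Apos v0 vA uA.
by apply: (generalized_eigen (c := 0) Apos v0 vA _).2; rewrite uA scale0r addr0.
Qed.

(** Let [t] be the largest |x_i| / v_i, reached at [i0]. Moduli in coordinate [i0] of x A = z x give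
    |z| t v_i0 <= t (v A)_i0 = r t v_i0, and t > 0 since x is nonzero. *)
Lemma dominant_eigenvalue A v (r : R) (z : R[i]) : pos_fun E A ->
  (forall i, 0 < v ord0 i) -> v *m A = r *: v ->
  eigenvalue (map_mx (real_complex R) A) z -> `|z| <= real_complex R r.
Proof.
move=> Apos v0 vA /eigenvalueP[x xA x0].
have /= [i0 _ i0max] := @arg_maxP _ _ _ ord0 xpredT
    (fun i => complex.Re `|x ord0 i| / v ord0 i) isT.
have nE (w : R[i]) : `|w| = real_complex R (complex.Re `|w|).
  by rewrite normc_def.
set t := complex.Re `|x ord0 i0| / v ord0 i0 in i0max.
have xt i : `|x ord0 i| <= real_complex R (t * v ord0 i).
  by rewrite nE lecR -ler_pdivrMr //; exact: i0max.
have t0 : 0 < t.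
  rewrite lt_neqAle -lecR.
  rewrite -[X in _ && X](pmulr_lge0 _ (x := real_complex R (v ord0 i0))) ?ltcR//.
  rewrite -rmorphM (le_trans _ (xt i0))// andbT.
  apply: contra x0 => /eqP t0; apply/eqP/rowP => i; rewrite mxE.
  by apply/eqP; rewrite -normr_le0 (le_trans (xt i))// -t0 mul0r.
have := congr1 (fun w : 'rV_d.+1 => `|w ord0 i0|) xA.
rewrite !mxE normrM => xAi0.
rewrite -(ler_pM2r (x := real_complex R (t * v ord0 i0))) ?ltcR ?(mulr_gt0 t0)//.
have -> : real_complex R (t * v ord0 i0) = `|x ord0 i0|.
  by rewrite /t divfK ?gt_eqF// -nE.
rewrite -xAi0 (le_trans (ler_norm_sum _ _ _))//.
have -> : (real_complex R r * `|x ord0 i0|) =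
    \sum_i real_complex R (t * v ord0 i * A i i0).
  rewrite nE -rmorphM -rmorph_sum/=; congr (real_complex R _).
  transitivity (t * (v *m A) ord0 i0).
    by rewrite vA !mxE mulrCA /t divfK// gt_eqF.
  by rewrite mxE mulr_sumr; apply: eq_bigr => i _; rewrite mulrA.
apply: ler_sum => i _; rewrite normrM [X in real_complex R X]mulrC.
rewrite !mxE [`|real_complex R _|]ger0_norm ?lecR ?(pos_fun_ge0 Apos)//.
by rewrite mulrC [leRHS]rmorphM/= ler_wpM2r// lecR (pos_fun_ge0 Apos).
Qed.

(* Adding the combination [v] of the rows of [X - A] to its first row makes
   [X - r] a factor of that row; the cofactor does not vanish at [r]. *)
Lemma simple_eigenvalue A v (r : R) : pos_fun E A ->
  (forall i, 0 < v ord0 i) -> v *m A = r *: v -> mup r (char_poly A) = 1%N.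
Proof.
move=> Apos v0 vA.
pose row0 (S : comNzRingType) (f : 'I_d.+1 -> S) (B : 'M[S]_d.+1) :=
  \matrix_(i, j) (if i == ord0 then f j else B i j).
pose M := row0 _ (fun j => (v ord0 j)%:P) (char_poly_mx A).
pose S : 'M[{poly R}]_d.+1 := row0 _ (fun j => (v ord0 j)%:P) 1%:M.
pose D : 'M[{poly R}]_d.+1 := diag_mx (\row_i (if i == ord0 then 'X - r%:P else 1)).
have SD : S *m char_poly_mx A = D *m M.
  apply/matrixP => i j; rewrite mul_diag_mx !mxE.
  have [->|i0] := eqVneq i ord0; last first.
    rewrite (bigD1 i)//= big1 => [|k ki]; rewrite !mxE (negbTE i0) ?eqxx.
      by rewrite addr0.
    by rewrite eq_sym (negbTE ki) mul0r.
  have := congr1 (fun w : 'rV_d.+1 => (w ord0 j)%:P) vA.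
  rewrite !mxE rmorph_sum/= polyCM => vAj.
  under eq_bigr => k _ do rewrite !mxE eqxx mulrBr.
  rewrite sumrB mulrBl (bigD1 j)//= big1 => [|k kj]; last first.
    by rewrite (negbTE kj) mulr0n mulr0.
  rewrite eqxx addr0 mulr1n mulrC -vAj; congr (_ - _).
  by apply: eq_bigr => k _; rewrite polyCM.
have detS : \det S = (v ord0 ord0)%:P.
  rewrite -det_tr det_trig; last first.
    apply/is_trig_mxP => i j ij; rewrite !mxE.
    case: eqVneq => [j0|_]; first by rewrite j0 in ij.
    by rewrite gt_eqF// -val_eqE/= gtn_eqF.
  rewrite (bigD1 ord0)//= big1 => [|i i0]; rewrite !mxE ?eqxx ?mulr1//.
  by rewrite (negbTE i0).
have detD : \det D = 'X - r%:P.
  rewrite det_diag (bigD1 ord0)//= big1 => [|i i0]; rewrite !mxE ?eqxx ?mulr1//.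
  by rewrite (negbTE i0).
have pE : (v ord0 ord0)%:P * char_poly A = ('X - r%:P) * \det M.
  by rewrite -detS -detD -!det_mulmx SD.
(* A left null vector [y] of [M] at [r], with its first coordinate replaced by 0, solves x A = r x +
   y_0 v. Hence y_0 = 0 and x is a multiple of [v]; as its first coordinate is 0, it vanishes, and
   so does [y]. *)
have Mr : ~~ root (\det M) r.
  apply/negP => /rootP; rewrite -horner_evalE -det_map_mx => /eqP/det0P[y y0].
  move=> /rowP yM.
  pose x := \row_i (if i == ord0 then 0 else y ord0 i).
  have xA : x *m A = r *: x + y ord0 ord0 *: v.
    apply/rowP => j; have := yM j; rewrite !mxE (bigD1 ord0)//= => /eqP.
    rewrite !mxE eqxx horner_evalE hornerC addr_eq0 => /eqP ->.
    rewrite (bigD1 ord0)//= !mxE eqxx mul0r add0r -sumrN.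
    have -> : r * (if j == ord0 then 0 else y ord0 j) =
      \sum_(i < d.+1 | i != ord0) (y ord0 i * (r *+ (i == j))).
      have [->|j0] := eqVneq j ord0.
        by rewrite mulr0 big1// => i /negbTE ->; rewrite mulr0.
      rewrite (bigD1 j)//= eqxx mulr1n big1 ?addr0 1?mulrC//.
      by move=> i /andP[_ /negbTE ->]; rewrite mulr0.
    rewrite -big_split/=; apply: eq_bigr => i i0.
    rewrite !mxE (negbTE i0) horner_evalE !hornerE/= hornerMn hornerX.
    by rewrite -mulrN -mulrDr opprB addrCA subrr addr0.
  have [yc [t xt]] := generalized_eigen Apos v0 vA xA.
  have t0 : t = 0.
    have /eqP := congr1 (fun w : 'rV_d.+1 => w ord0 ord0) xt.
    by rewrite !mxE eqxx eq_sym mulf_eq0 [X in _ || X]gt_eqF// orbF => /eqP.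
  case/eqP: y0; apply/rowP => j; rewrite mxE.
  have := congr1 (fun w : 'rV_d.+1 => w ord0 j) xt.
  by rewrite t0 scale0r !mxE; case: eqVneq => [->|].
have : mup r ((v ord0 ord0)%:P * char_poly A) = 1%N.
  by rewrite pE mupMl// -[X in mup r X]expr1 mup_XsubCX eqxx.
by rewrite mupMr// rootC gt_eqF.
Qed.

Lemma is_perron_rootP A v (r : R) : pos_fun E A -> 0 < r ->
  (forall i, 0 < v ord0 i) -> v *m A = r *: v -> is_perron_root A r.
Proof.
move=> Apos r0 v0 vA; split=> //; first exact: simple_eigenvalue vA.
by move=> z; exact: dominant_eigenvalue vA.
Qed.

Lemma out_edge (x : 'I_d.+1) : exists y, (x, y) \in E.
Proof.
by have [[|y s] // _ [/= /andP[xy _] _]] := Econ x x; exists y.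
Qed.

Lemma in_edge (x : 'I_d.+1) : exists y, (y, x) \in E.
Proof.
have [s s0 [+ sx]] := Econ x x; rewrite -[s](@cat_take_drop (size s).-1).
elim/last_ind: s s0 sx => // s y _ _; rewrite last_rcons => ->.
rewrite cat_take_drop rcons_path => /andP[_ ?]; by exists (last x s).
Qed.

(** The summand 1 lets a walk wait, so a positive entry stays positive in all higher powers; the
    maximum of the exponents found for single pairs then serves all pairs. *)
Lemma positive_power A : pos_fun E A ->
  exists n, forall i j, 0 < ((1 + A) ^+ n) i j.
Proof.
move=> Apos.
have B0 n i j : 0 <= ((1 + A) ^+ n) i j.
  elim: n i j => [|n IH] i j; first by rewrite expr0 mxE ler0n.
  rewrite exprSr mulrDr mulr1 !mxE addr_ge0// sumr_ge0// => k _.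
  by rewrite mulr_ge0 ?(pos_fun_ge0 Apos).
have Bmono m n i j : (m <= n)%N -> 0 < ((1 + A) ^+ m) i j -> 0 < ((1 + A) ^+ n) i j.
  move=> /subnK <-; elim: (n - m)%N => // k IH /IH.
  rewrite addSn exprSr mulrDr mulr1 mxE [X in _ -> 0 < _ + X]mxE => Bij.
  by rewrite ltr_wpDr// sumr_ge0// => l _; rewrite mulr_ge0 ?(pos_fun_ge0 Apos).
have step n i j k : (j, k) \in E -> 0 < ((1 + A) ^+ n) i j ->
    0 < ((1 + A) ^+ n.+1) i k.
  move=> jk Bij; rewrite exprSr mulrDr mulr1 mxE ltr_wpDl// mxE (bigD1 j)//=.
  rewrite ltr_wpDr ?mulr_gt0//; last exact: Apos.2.
  by rewrite sumr_ge0// => l _; rewrite mulr_ge0 ?(pos_fun_ge0 Apos).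
have /choice[N NP] : forall p : 'I_d.+1 * 'I_d.+1,
    exists n, 0 < ((1 + A) ^+ n) p.1 p.2.
  move=> [i j] /=; have [s _ [+ <-]] := Econ i j.
  elim/last_ind: s => [|s k IH]; first by exists 0%N; rewrite expr0 mxE eqxx.
  rewrite rcons_path last_rcons => /andP[/IH[n Bn] sk].
  by exists n.+1; exact: step Bn.
exists (\max_p N p) => i j; apply: (Bmono (N (i, j))); last exact: NP (i, j).
exact: (leq_bigmax (i, j)).
Qed.

(* The maximal [t] such that [t v <= v A] for some [v] in the simplex is
   attained; there equality holds, since otherwise a positive power of [1 + A]
   would turn [v] into a vector admitting a larger [t]. *)
Lemma perron_vector_exists A : pos_fun E A -> exists (r : R) v,
  [/\ 0 < r, forall i, 0 < v ord0 i, \sum_i v ord0 i = 1 & v *m A = r *: v].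
Proof.
move=> Apos; have A0 := pos_fun_ge0 Apos.
pose C := [set p : 'rV[R]_d.+1 * R | [/\ forall i, 0 <= p.1 ord0 i,
  \sum_i p.1 ord0 i = 1, 0 <= p.2 &
  forall i, 0 <= (p.1 *m A) ord0 i - p.2 * p.1 ord0 i]].
(* An upper bound for the second component on [C]: sum t v_i <= (v A)_i over i and use that the
   coordinates of [v] are at most 1 with sum 1. *)
pose T := \sum_j \sum_i A i j.
have coord1 i : continuous (fun p : 'rV[R]_d.+1 * R => p.1 ord0 i).
  move=> p; apply: (@continuous_comp _ _ _ fst (fun v : 'rV[R]_d.+1 => v ord0 i)).
    exact: cvg_fst.
  exact: coord_continuous.
have Ccompact : compact C.
  have S0 : compact [set v : 'rV[R]_d.+1 | forall i, `[0, 1]%classic (v ord0 i)].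
    exact: (@rV_compact R _ (fun=> `[0, 1]%classic) (fun=> @segment_compact R 0 1)).
  apply: subclosed_compact (compact_setX S0 (@segment_compact _ 0 T)) _.
    have ge0_closed (g : 'rV[R]_d.+1 * R -> R) : continuous g ->
        closed [set p | 0 <= g p].
      move=> gc; apply: (@preimage_closed _ _ g [set t | 0 <= t]).
        by move=> p _; exact: gc.
      exact: closed_ge.
    pose Q (g : 'rV[R]_d.+1 * R -> R) := [set p | 0 <= g p].
    have -> : C = (\bigcap_i Q (fun p => p.1 ord0 i)) `&`
        (Q (fun p => (\sum_i p.1 ord0 i) - 1) `&`
         Q (fun p => 1 - (\sum_i p.1 ord0 i))) `&` Q snd `&`
         \bigcap_i Q (fun p => (p.1 *m A) ord0 i - p.2 * p.1 ord0 i).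
      apply/seteqP; split=> [p [p0 ps pt pA]|p [[[p0 [ps1 ps2]] pt] pA]].
        by split; [split; [split; [|split]|]|] => [i _||||i _]; rewrite /Q/= ?ps ?subrr.
      split=> [i|||i]; [exact: p0| |by []|exact: pA].
      by apply/eqP; rewrite eq_le -subr_ge0 ps2 -subr_ge0 ps1.
    have sumc : continuous (fun p : 'rV[R]_d.+1 * R => \sum_i p.1 ord0 i).
      by move=> p; apply: cvgr_sum => i _; exact: coord1.
    apply: closedI; first apply: closedI; first apply: closedI.
    - by apply: closed_bigI => i _; apply: ge0_closed.
    - apply: closedI; apply: ge0_closed => p; apply: cvgB => //;
        [exact: sumc|exact: cvg_cst|exact: cvg_cst|exact: sumc].
    - by apply: ge0_closed => p; exact: cvg_snd.
    apply: closed_bigI => i _; apply: ge0_closed => p; apply: cvgB; last first.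
      by apply: cvgM; [exact: cvg_snd|exact: coord1].
    under eq_fun do rewrite mxE; rewrite mxE.
    by apply: cvgr_sum => j _; apply: cvgMl; exact: coord1.
  move=> p [p0 ps pt pA].
  have p1 i : p.1 ord0 i <= 1.
    by rewrite -ps (bigD1 i)//= lerDl sumr_ge0.
  split=> /= [i|]; rewrite in_itv/= ?p0 ?p1 ?pt//=.
  rewrite -[p.2]mulr1 -ps mulr_sumr; apply: ler_sum => i _.
  have := pA i; rewrite subr_ge0 => /le_trans; apply.
  by rewrite mxE; apply: ler_sum => j _; rewrite ler_piMl.
have C0 : C !=set0.
  exists (\row_i d.+1%:R^-1, 0); split=> //= [i||i]; rewrite ?mxE ?invr_ge0//.
    under eq_bigr do rewrite mxE.
    by rewrite sumr_const card_ord -[LHS]mulr_natl divff ?pnatr_eq0.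
  rewrite mul0r subr0 sumr_ge0// => j _.
  by rewrite mxE mulr_ge0// invr_ge0.
have [|[v t] /set_mem[/= v0 vs t0 vA] tmax] :=
    compact_EVT_max C0 Ccompact (f := snd).
  by apply: continuous_subspaceT => p; exact: cvg_snd.
have [n P0] := positive_power Apos; set P := (1 + A) ^+ n in P0.
have AP : A *m P = P *m A.
  by apply: (commrX n); rewrite /GRing.comm mulrDr mulrDl mulr1 mul1r.
have vecP (u : 'rV[R]_d.+1) : (forall i, 0 <= u ord0 i) -> u != 0 ->
    forall i, 0 < (u *m P) ord0 i.
  move=> u0 un0 i; have [j uj] : exists j, u ord0 j != 0.
    apply/existsP; apply: contraR un0; rewrite negb_exists => /forallP uE.
    by apply/eqP/rowP => j; rewrite mxE; apply/eqP; rewrite -[_ == _]negbK.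
  rewrite mxE (bigD1 j)//= ltr_wpDr//; last by rewrite mulr_gt0// lt0r uj u0.
  by rewrite sumr_ge0// => k _; rewrite mulr_ge0// ltW.
have vn0 : v != 0.
  apply/eqP => vE; have /eqP := vs; rewrite vE big1 ?(eq_sym 0) ?oner_eq0//.
  by move=> i _; rewrite mxE.
have vAt : v *m A = t *: v.
  apply/eqP; rewrite -subr_eq0; apply: contraT => yn0.
  set y := v *m A - t *: v in yn0.
  have y0 i : 0 <= y ord0 i by have := vA i; rewrite !mxE.
  have w0 := vecP _ v0 vn0; have yP0 := vecP _ y0 yn0.
  set w := v *m P in w0.
  have yPE : y *m P = w *m A - t *: w.
    by rewrite mulmxBl -!mulmxA AP mulmxA -scalemxAl.
  (* The defect w A - t w = y P is positive everywhere, so the smallest ratio [e] of its coordinates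
     to those of [w] can be added to [t]. *)
  have /= [i0 _ i0min] := @arg_minP _ _ _ ord0 xpredT
    (fun i => (y *m P) ord0 i / w ord0 i) isT.
  set e := (y *m P) ord0 i0 / w ord0 i0 in i0min.
  have e0 : 0 < e by rewrite divr_gt0.
  pose s := \sum_i w ord0 i.
  have s0 : 0 < s.
    by rewrite /s (bigD1 ord0)//= ltr_wpDr// sumr_ge0// => i _; exact: ltW.
  have : C (s^-1 *: w, t + e).
    split=> /= [i|||i].
    - by rewrite mxE mulr_ge0 ?invr_ge0// ltW.
    - under eq_bigr do rewrite mxE.
      by rewrite -mulr_sumr mulVf// gt_eqF.
    - by rewrite addr_ge0// ltW.
    rewrite -scalemxAl mxE [X in _ - _ * X]mxE mulrCA -mulrBr mulr_ge0//.
      by rewrite invr_ge0 ltW.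
    have := i0min i isT; rewrite ler_pdivlMr//.
    have -> : (y *m P) ord0 i = (w *m A) ord0 i - t * w ord0 i.
      by rewrite yPE !mxE.
    by rewrite -subr_ge0 mulrDl opprD addrA.
  by move=> /mem_set /tmax /=; rewrite gerDl leNgt e0.
have vgt0 i : 0 < v ord0 i.
  rewrite lt0r v0 andbT; apply/eqP => vi.
  by case/eqP: vn0; exact: (eigen_zero Apos v0 vAt vi).
exists t, v; split=> //; rewrite lt0r t0 andbT; apply/eqP => tE.
have [k ik] := out_edge ord0.
have /eqP := congr1 (fun u : 'rV_d.+1 => u ord0 k) vAt.
rewrite tE scale0r !mxE psumr_eq0 => [|l _]; last by rewrite mulr_ge0.
move=> /allP/(_ ord0); rewrite mem_index_enum => /(_ isT)/implyP/(_ isT).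
by rewrite mulf_eq0 !gt_eqF//; apply Apos.2.
Qed.

(** Multiplicity 1 makes each candidate an eigenvalue, so the dominance of either one bounds the
    other. *)
Lemma is_perron_root_unique A (r s : R) :
  is_perron_root A r -> is_perron_root A s -> r = s.
Proof.
have root_le (a b : R) : is_perron_root A a -> is_perron_root A b -> a <= b.
  move=> [a0 amup _] [_ _ bmax].
  have ra : root (char_poly A) a.
    by apply/negPn/negP => /mupNroot; rewrite amup.
  have := bmax (real_complex R a); rewrite eigenvalue_map eigenvalue_root_char.
  have aC0 : 0 <= real_complex R a by rewrite lecR ltW.
  by move=> /(_ ra); rewrite ger0_norm// lecR.
by move=> rA sA; apply/eqP; rewrite eq_le !root_le.
Qed.

(** This evaluates the choices made by [get]: one normalised positive eigenvector identifies the
    root and [mu] together. *)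
Lemma perron_eigen A v (r : R) : pos_fun E A -> 0 < r ->
  (forall i, 0 < v ord0 i) -> \sum_i v ord0 i = 1 -> v *m A = r *: v ->
  perron_root A = r /\ mu A = v.
Proof.
move=> Apos r0 v0 vs vA; have rA := is_perron_rootP Apos r0 v0 vA.
have rE : perron_root A = r.
  apply: (is_perron_root_unique _ rA).
  exact: (getI (P := [set x | is_perron_root A x]) rA).
split=> //; set Q := [set u : 'rV[R]_d.+1 |
  [/\ u *m A = perron_root A *: u, forall i, 0 < u ord0 i & \sum_i u ord0 i = 1]].
have [muA _ mus] : Q (mu A) by apply: (getI (x := v)); rewrite /Q /= rE.
rewrite rE in muA.
have [t muE] := left_eigen_unique Apos v0 vA muA.
move: mus; rewrite muE; under eq_bigr do rewrite mxE.
by rewrite -mulr_sumr vs mulr1 => ->; rewrite scale1r.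
Qed.

Lemma muP A : pos_fun E A -> [/\ 0 < perron_root A,
  forall i, 0 < mu A ord0 i, \sum_i mu A ord0 i = 1 &
  mu A *m A = perron_root A *: mu A].
Proof.
move=> Apos; have [r [v [r0 v0 vs vA]]] := perron_vector_exists Apos.
by have [-> ->] := perron_eigen Apos r0 v0 vs vA.
Qed.

End PerronFrobenius.

(** * Smooth functions on a relatively open set *)

(** Directional derivatives become derivatives of functions of one real variable, so that locality
    concerns only nearby points of a line; relative openness provides exactly those. *)
Lemma derive_line (R : realType) (U Z : normedModType R) (f : U -> Z) u v :
  'D_v f u = 'D_1 (fun h : R => f (u + h *: v)) 0 /\
  (derivable f u v <-> derivable (fun h : R => f (u + h *: v)) 0 1).
Proof.
rewrite /derive /derivable.
suff -> : (fun h : R => h^-1 *: ((f \o shift u) (h *: v) - f u)) =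
    (fun h : R => h^-1 *: (((fun h : R => f (u + h *: v)) \o shift 0) (h *: 1) -
      f (u + 0 *: v))) by [].
apply/funext => h /=; rewrite addr0 scale0r addr0 [h *: v + u]addrC.
by rewrite /GRing.scale/= mulr1.
Qed.

Lemma is_derive_line (R : realType) (U Z : normedModType R) (f : U -> Z) u v l :
  is_derive u v f l <-> is_derive (0 : R) (1 : R) (fun h : R => f (u + h *: v)) l.
Proof.
have [Dl dl] := derive_line f u v.
by split=> -[/dl fd <-]; split.
Qed.

Lemma is_derive_cvg (R : realType) (U Z : normedModType R) (f : U -> Z) u v l :
  (fun h : R => h^-1 *: ((f \o shift u) (h *: v) - f u)) @ 0^' --> l ->
  is_derive u v f l.
Proof. by move=> fl; split; [apply/cvg_ex; exists l|exact: cvg_lim]. Qed.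

(** An unbundled predicate, so that it applies directly to functions such as
    [fun v => in_sum E v x]. *)
Definition linear_map (R : realType) (Y Z : normedModType R) (c : Y -> Z) :=
  forall (a : R) u v, c (a *: u + v) = a *: c u + c v.

Section LinearMap.
Variables (R : realType) (Y Z : normedModType R) (c : Y -> Z).
Hypothesis c_lin : linear_map c.

Lemma linear_map0 : c 0 = 0.
Proof.
have := c_lin (-1) 0 0; rewrite scaler0 addr0 => c0.
by rewrite {1}c0 scaleN1r addNr.
Qed.

Lemma linear_mapZ a u : c (a *: u) = a *: c u.
Proof. by rewrite -[a *: u]addr0 c_lin linear_map0 addr0. Qed.

Lemma linear_mapD u v : c (u + v) = c u + c v.
Proof. by rewrite -[u]scale1r c_lin !scale1r. Qed.

Lemma linear_mapB u v : c (u - v) = c u - c v.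
Proof. by rewrite addrC -scaleN1r c_lin scaleN1r addrC. Qed.

Lemma linear_map_sum (I : Type) (r : seq I) (P : pred I) (f : I -> Y) :
  c (\sum_(i <- r | P i) f i) = \sum_(i <- r | P i) c (f i).
Proof.
elim/big_rec2: _ => [|i x y _ <-]; first exact: linear_map0.
exact: linear_mapD.
Qed.

End LinearMap.

Lemma is_derive_comp_linear (R : realType) (U Y Z : normedModType R)
    (c : Y -> Z) (f : U -> Y) u v l : linear_map c ->
  continuous c -> is_derive u v f l -> is_derive u v (c \o f) (c l).
Proof.
move=> c_lin cc [fd <-]; apply: is_derive_cvg.
have -> : (fun h : R => h^-1 *: (((c \o f) \o shift u) (h *: v) - (c \o f) u)) =
    c \o (fun h : R => h^-1 *: ((f \o shift u) (h *: v) - f u)).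
  apply/funext => h; rewrite /comp [RHS](linear_mapZ c_lin); congr (_ *: _).
  by rewrite (linear_mapB c_lin).
by apply: continuous_cvg; [exact: cc|exact: fd].
Qed.

Definition relatively_open (R : realType) (U : normedModType R) (A V : set U) :=
  [/\ V 0, forall (a : R) u v, V u -> V v -> V (a *: u + v) &
      forall u, A u -> \forall v \near (0 : U), V v -> A (u + v)].

Section SmoothOn.
Variables (R : realType) (U : normedModType R) (A V : set U).
Hypothesis AV : relatively_open A V.

Let V_0 : V 0. Proof. by case: AV. Qed.
Let V_lin (a : R) u v : V u -> V v -> V (a *: u + v).
Proof. by case: AV => _ + _; apply. Qed.
Let A_open u : A u -> \forall v \near (0 : U), V v -> A (u + v).
Proof. by case: AV => _ _; apply. Qed.

Lemma dirs_scale (a : R) v : V v -> V (a *: v).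
Proof. by move=> Vv; rewrite -[a *: v]addr0; exact: V_lin. Qed.

Lemma dirs_sum (I : Type) (r : seq I) (P : pred I) (f : I -> U) :
  (forall i, P i -> V (f i)) -> V (\sum_(i <- r | P i) f i).
Proof.
move=> fV; elim/big_ind: _ => // u v Vu Vv.
by rewrite -[u]scale1r; exact: V_lin.
Qed.

Lemma near_line u v : A u -> V v -> \forall h \near (0 : R), A (u + h *: v).
Proof.
move=> Au Vv.
have : (h *: v) @[h --> (0 : R)] --> (0 : U).
  by rewrite -[X in _ --> X](scale0r v); apply: cvgZl; exact: cvg_id.
move=> /(_ _ (A_open Au)) Auh; near=> h.
have : V (h *: v) -> A (u + h *: v) by near: h; exact: Auh.
by apply; exact: dirs_scale.
Unshelve. all: by end_near. Qed.

Lemma eq_on_is_derive (Z : normedModType R) (f g : U -> Z) u v l :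
  (forall x, A x -> f x = g x) -> A u -> V v ->
  is_derive u v f l -> is_derive u v g l.
Proof.
move=> fg Au Vv /is_derive_line fl; apply/is_derive_line.
apply: near_eq_is_derive fl; near=> h; apply: fg; near: h.
exact: near_line.
Unshelve. all: by end_near. Qed.

Lemma eq_on_derive (Z : normedModType R) (f g : U -> Z) u v :
  (forall x, A x -> f x = g x) -> A u -> V v -> 'D_v f u = 'D_v g u.
Proof.
move=> fg Au Vv.
rewrite (derive_line f u v).1 (derive_line g u v).1.
apply: near_eq_derive; near=> h; apply: fg; near: h.
exact: near_line.
Unshelve. all: by end_near. Qed.

(** In [iter_derive] the last vector of the list acts first. Peeling the list at its end thus
    expresses smoothness of [f] by that of its first derivatives. *)
Lemma smooth_onP (Z : normedModType R) (f : U -> Z) : smooth_on A V f <->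
  [/\ {within A, continuous f}, forall u v, A u -> V v -> derivable f u v &
      forall v, V v -> smooth_on A V ('D_v f)].
Proof.
have iterE (g : U -> Z) vs v : iter_derive g (rcons vs v) = iter_derive ('D_v g) vs.
  by elim: vs => //= w vs ->.
split=> [fs|[fc fd fs] vs]; first split.
- by have [|] := fs [::].
- by have [|_] := fs [::].
- move=> v Vv vs vsV; rewrite -iterE; apply: fs => w.
  by rewrite mem_rcons inE => /orP[/eqP ->//|/vsV].
case: (lastP vs) => // {}vs v vsV.
rewrite iterE; apply: fs => [|w wvs]; apply: vsV; rewrite mem_rcons inE ?eqxx//.
by rewrite wvs orbT.
Qed.

(** A coinduction principle: it is enough to exhibit a class of continuous functions closed under
    directional derivatives, up to equality on [A], and no formula for higher derivatives is ever
    written. *)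
Lemma smooth_on_coind (Z : normedModType R) (P : (U -> Z) -> Prop) :
  (forall f, P f -> {within A, continuous f} /\
    forall v, V v -> exists2 g, P g & forall u, A u -> is_derive u v f (g u)) ->
  forall f, P f -> smooth_on A V f.
Proof.
move=> Pstep f Pf vs vsV.
have [g Pg fg] : exists2 g, P g & forall u, A u -> iter_derive f vs u = g u.
  elim: vs vsV => [|v vs IH] vsV /=; first by exists f.
  have [w wvs|g Pg fg] := IH; first by apply: vsV; rewrite inE wvs orbT.
  have [_ /(_ v (vsV v (mem_head _ _)))[h Ph gh]] := Pstep _ Pg.
  exists h => // u Au; rewrite -(gh u Au).(derive_val).
  by apply: eq_on_derive => //; exact: vsV (mem_head _ _).
have [gc gd] := Pstep _ Pg; split.
  apply: (@subspace_eq_continuous _ _ _ g) gc => u /set_mem Au.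
  by rewrite /from_subspace fg.
move=> u v Au Vv; have [h _ /(_ u Au) gh] := gd v Vv.
have : is_derive u v (iter_derive f vs) (h u).
  by apply: eq_on_is_derive gh => // x Ax; rewrite fg.
by case.
Qed.

Lemma smooth_on_is_derive (Z : normedModType R) (f : U -> Z) u v :
  smooth_on A V f -> A u -> V v -> is_derive u v f ('D_v f u).
Proof. by move=> /smooth_onP[_ fd _] Au Vv; apply: derivableP; exact: fd. Qed.

Lemma smooth_on_derive (Z : normedModType R) (f : U -> Z) v :
  smooth_on A V f -> V v -> smooth_on A V ('D_v f).
Proof. by move=> /smooth_onP[_ _]; exact. Qed.

Lemma smooth_on_cvg (Z : normedModType R) (f : U -> Z) u :
  smooth_on A V f -> A u -> f @ within A (nbhs u) --> f u.
Proof. by move=> /smooth_onP[/subspace_continuousP fc _ _]; exact: fc. Qed.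

Lemma eq_on_smooth (Z : normedModType R) (f g : U -> Z) :
  (forall x, A x -> f x = g x) -> smooth_on A V f -> smooth_on A V g.
Proof.
move=> fg fs.
apply: (@smooth_on_coind _ (fun g => exists2 f, smooth_on A V f &
  forall x, A x -> f x = g x)); last by exists f.
move=> {fs fg f} {}g [f fs fg]; split.
  have [fc _ _] := (smooth_onP f).1 fs; apply: (@subspace_eq_continuous _ _ _ f) fc.
  by move=> u /set_mem Au; rewrite /from_subspace fg.
move=> v Vv; exists ('D_v f); first by exists ('D_v f) => //; exact: smooth_on_derive.
move=> u Au; apply: (eq_on_is_derive fg) => //; exact: smooth_on_is_derive.
Qed.

Lemma smooth_on_cst (Z : normedModType R) (c : Z) : smooth_on A V (fun=> c).
Proof.
apply: (@smooth_on_coind _ (fun f => exists c, f = fun=> c)); last by exists c.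
move=> _ [{}c ->]; split; first by apply: continuous_subspaceT => x; exact: cvg_cst.
by move=> v Vv; exists (fun=> 0) => [|u Au]; [exists 0|exact: is_derive_cst].
Qed.

Lemma smooth_on_comp_linear (Y Z : normedModType R) (c : Y -> Z)
    (f : U -> Y) :
  linear_map c -> continuous c -> smooth_on A V f -> smooth_on A V (c \o f).
Proof.
move=> c_lin cc fs; apply: (@smooth_on_coind _ (fun g => exists2 f, smooth_on A V f &
  g = c \o f)); last by exists f.
move=> {fs f} _ [f fs ->]; split.
  apply/subspace_continuousP => u Au.
  by apply: continuous_cvg; [exact: cc|exact: smooth_on_cvg].
move=> v Vv; exists (c \o 'D_v f).
  by exists ('D_v f) => //; exact: smooth_on_derive.
move=> u Au; apply: is_derive_comp_linear => //; exact: smooth_on_is_derive.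
Qed.

End SmoothOn.

Section SmoothAlgebra.
Variables (R : realType) (U : normedModType R) (A V : set U).
Hypothesis AV : relatively_open A V.
Implicit Types f g : U -> R.

(* Closed under directional derivatives, up to equality on [A]. *)
Inductive smooth_term : (U -> R) -> Prop :=
| SmoothBase f of smooth_on A V f : smooth_term f
| SmoothAdd f g of smooth_term f & smooth_term g : smooth_term (fun u => f u + g u)
| SmoothMul f g of smooth_term f & smooth_term g : smooth_term (fun u => f u * g u)
| SmoothInv f of smooth_term f & (forall u, A u -> f u != 0) :
    smooth_term (fun u => (f u)^-1)
| SmoothLn f of smooth_term f & (forall u, A u -> 0 < f u) :
    smooth_term (fun u => ln (f u)).

Lemma is_derive_inv f u v l : f u != 0 -> is_derive u v f l ->
  is_derive u v (fun x => (f x)^-1) (- l * (f u)^-1 * (f u)^-1).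
Proof.
move=> fu [fd <-]; split; first exact: derivableV.
by rewrite deriveV// /GRing.scale/= expr2 invfM; ring.
Qed.

Lemma is_derive_ln f u v l : 0 < f u -> is_derive u v f l ->
  is_derive u v (fun x => ln (f x)) (l * (f u)^-1).
Proof.
move=> fu /is_derive_line fl; apply/is_derive_line.
have lnfu : is_derive (f (u + 0 *: v)) 1 (@ln R) (f u)^-1.
  by rewrite scale0r addr0; exact: is_derive1_ln.
by rewrite mulrC; exact: (is_derive1_comp (g := fun h => f (u + h *: v)) lnfu fl).
Qed.

Lemma is_derive_mul f g u v l m : is_derive u v f l -> is_derive u v g m ->
  is_derive u v (fun x => f x * g x) (l * g u + f u * m).
Proof.
move=> fl gm; apply: is_derive_eq (is_deriveM fl gm) _.
by rewrite /GRing.scale/= addrC [g u * l]mulrC.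
Qed.

Lemma smooth_term_smooth f : smooth_term f -> smooth_on A V f.
Proof.
apply: smooth_on_coind => // {}f; elim=> {f}
  [f fs|f g _ [fc fd] _ [gc gd]|f g fs [fc fd] gs [gc gd]
  |f fs [fc fd] f0|f fs [fc fd] f0].
- have [fc _ _] := (smooth_onP A V f).1 fs; split=> // v Vv; exists ('D_v f).
    by apply: SmoothBase; exact: smooth_on_derive.
  by move=> u Au; exact: (smooth_on_is_derive fs Au Vv).
- split=> [|v Vv].
    by move/subspace_continuousP in fc; move/subspace_continuousP in gc;
       apply/subspace_continuousP => u Au; apply: cvgD; [exact: fc|exact: gc].
  have [f' sf' ff'] := fd _ Vv; have [g' sg' gg'] := gd _ Vv.
  exists (fun u => f' u + g' u); first exact: SmoothAdd.
  by move=> u Au; apply: is_deriveD; [exact: ff'|exact: gg'].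
- split=> [|v Vv].
    by move/subspace_continuousP in fc; move/subspace_continuousP in gc;
       apply/subspace_continuousP => u Au; apply: cvgM; [exact: fc|exact: gc].
  have [f' sf' ff'] := fd _ Vv; have [g' sg' gg'] := gd _ Vv.
  exists (fun u => f' u * g u + f u * g' u).
    by apply: SmoothAdd; exact: SmoothMul.
  by move=> u Au; apply: is_derive_mul; [exact: ff'|exact: gg'].
- split=> [|v Vv].
    by move/subspace_continuousP in fc; apply/subspace_continuousP => u Au;
       apply: cvgV; [exact: f0|exact: fc].
  have [f' sf' ff'] := fd _ Vv.
  exists (fun u => (- 1) * f' u * (f u)^-1 * (f u)^-1).
    do 2![apply: SmoothMul; last exact: SmoothInv].
    by apply: SmoothMul => //; apply: SmoothBase; exact: smooth_on_cst.
  by move=> u Au; rewrite mulN1r; apply: is_derive_inv; [exact: f0|exact: ff'].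
split=> [|v Vv].
  move/subspace_continuousP in fc; apply/subspace_continuousP => u Au.
  by apply: continuous_cvg; [apply: continuous_ln; exact: f0|exact: fc].
have [f' sf' ff'] := fd _ Vv.
exists (fun u => f' u * (f u)^-1).
  by apply: SmoothMul => //; apply: SmoothInv => // u Au; rewrite gt_eqF// f0.
by move=> u Au; apply: is_derive_ln; [exact: f0|exact: ff'].
Qed.

Lemma smooth_on_add f g : smooth_on A V f -> smooth_on A V g ->
  smooth_on A V (fun u => f u + g u).
Proof.
by move=> fs gs; apply: smooth_term_smooth; apply: SmoothAdd; exact: SmoothBase.
Qed.

Lemma smooth_on_mul f g : smooth_on A V f -> smooth_on A V g ->
  smooth_on A V (fun u => f u * g u).
Proof.
by move=> fs gs; apply: smooth_term_smooth; apply: SmoothMul; exact: SmoothBase.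
Qed.

Lemma smooth_on_inv f : smooth_on A V f -> (forall u, A u -> f u != 0) ->
  smooth_on A V (fun u => (f u)^-1).
Proof.
by move=> fs f0; apply: smooth_term_smooth; apply: SmoothInv => //; exact: SmoothBase.
Qed.

Lemma smooth_on_ln f : smooth_on A V f -> (forall u, A u -> 0 < f u) ->
  smooth_on A V (fun u => ln (f u)).
Proof.
by move=> fs f0; apply: smooth_term_smooth; apply: SmoothLn => //; exact: SmoothBase.
Qed.

Lemma smooth_on_opp f : smooth_on A V f -> smooth_on A V (fun u => - f u).
Proof.
move=> fs; apply: (eq_on_smooth AV (f := fun u => -1 * f u)).
  by move=> u _; rewrite mulN1r.
exact: (smooth_on_mul (@smooth_on_cst _ _ _ _ AV R (-1)) fs).
Qed.

Lemma smooth_on_sub f g : smooth_on A V f -> smooth_on A V g ->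
  smooth_on A V (fun u => f u - g u).
Proof. by move=> fs gs; exact: (smooth_on_add fs (smooth_on_opp gs)). Qed.

Lemma smooth_on_sum (I : Type) (r : seq I) (P : pred I) (f : I -> U -> R) :
  (forall i, P i -> smooth_on A V (f i)) ->
  smooth_on A V (fun u => \sum_(i <- r | P i) f i u).
Proof.
move=> fs; elim: r => [|i r IH].
  by apply: (eq_on_smooth AV) (smooth_on_cst AV 0) => u _; rewrite big_nil.
case: (boolP (P i)) => Pi.
  apply: (eq_on_smooth AV) (smooth_on_add (fs i Pi) IH) => u _.
  by rewrite big_cons Pi.
by apply: (eq_on_smooth AV) IH => u _; rewrite big_cons (negbTE Pi).
Qed.

Lemma smooth_on_prod (I : Type) (r : seq I) (P : pred I) (f : I -> U -> R) :
  (forall i, P i -> smooth_on A V (f i)) ->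
  @smooth_on R U R A V (fun u => \prod_(i <- r | P i) f i u).
Proof.
move=> fs; elim: r => [|i r IH].
  apply: (eq_on_smooth AV (f := fun=> (1 : R))); last exact: smooth_on_cst.
  by move=> u _; rewrite big_nil.
case: (boolP (P i)) => Pi.
  apply: (eq_on_smooth AV) (smooth_on_mul (fs i Pi) IH) => u _.
  by rewrite big_cons Pi.
by apply: (eq_on_smooth AV) IH => u _; rewrite big_cons (negbTE Pi).
Qed.

Lemma is_derive_bigsum (Z : normedModType R) (I : Type) (r : seq I) (P : pred I)
    (f : I -> U -> Z) (l : I -> Z) u v :
  (forall i, P i -> is_derive u v (f i) (l i)) ->
  is_derive u v (fun x => \sum_(i <- r | P i) f i x) (\sum_(i <- r | P i) l i).
Proof.
move=> fl; elim: r => [|i r IH].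
  rewrite big_nil; under eq_fun do rewrite big_nil; exact: is_derive_cst.
rewrite big_cons; under eq_fun do rewrite big_cons.
by case: (boolP (P i)) => // Pi; apply: is_deriveD => //; exact: fl.
Qed.

Lemma is_derive_scale_vec (Z : normedModType R) (f : U -> R) (e : Z) u v l :
  is_derive u v f l -> is_derive u v (fun x => f x *: e) (l *: e).
Proof.
apply: (@is_derive_comp_linear _ _ _ _ (fun a : R => a *: e)) => [a b c|a].
  by rewrite scalerDl scalerA.
by apply: cvgZl; exact: cvg_id.
Qed.

Lemma smooth_on_comb (Z : normedModType R) (I : finType) (f : I -> U -> R)
    (e : I -> Z) : (forall i, smooth_on A V (f i)) ->
  smooth_on A V (fun u => \sum_i f i u *: e i).
Proof.
move=> fs; apply: (@smooth_on_coind _ _ _ _ AV Z (fun g : U -> Z =>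
  exists2 f : I -> U -> R, (forall i, smooth_on A V (f i)) &
    g = fun u => \sum_i f i u *: e i)).
  move=> {f fs} _ [f fs ->]; split.
    apply/subspace_continuousP => u Au; apply: cvgr_sum => i _.
    by apply: cvgZl; exact: smooth_on_cvg (fs i) Au.
  move=> v Vv; exists (fun u => \sum_i 'D_v (f i) u *: e i).
    exists (fun i => 'D_v (f i)); last by [].
    by move=> i; exact: (smooth_on_derive (fs i) Vv).
  move=> u Au; apply: is_derive_bigsum => i _; apply: is_derive_scale_vec.
  exact: (smooth_on_is_derive (fs i) Au Vv).
by exists f.
Qed.

Lemma smooth_on_linear (Z : normedModType R) (c : U -> Z) :
  linear_map c -> continuous c -> smooth_on A V c.
Proof.
move=> c_lin cc; apply: (@smooth_on_coind _ _ _ _ AV Z (fun g : U -> Z => (g = c) \/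
  (exists z, g = fun=> z))); last by left.
move=> _ [->|[z ->]]; split.
- exact: continuous_subspaceT.
- move=> v Vv; exists (fun=> c v) => [|u Au]; first by right; exists (c v).
  by apply: (@is_derive_comp_linear _ _ _ _ c id) => //; exact: is_derive_id.
- by apply: continuous_subspaceT => x; exact: cvg_cst.
by move=> v Vv; exists (fun=> 0) => [|u Au]; [right; exists 0|exact: is_derive_cst].
Qed.

End SmoothAlgebra.

(** * Chain rule along a frame, linearity in the direction, symmetry of second derivatives *)

Lemma is_derive0P (R : realType) (Z : normedModType R) (F : R -> Z) l :
  is_derive (0 : R) (1 : R) F l <->
  (fun h : R => h^-1 *: (F h - F 0)) @ 0^' --> l.
Proof.
have E : (fun h : R => h^-1 *: ((F \o shift 0) (h *: (1 : R)) - F 0)) =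
    (fun h : R => h^-1 *: (F h - F 0)).
  by apply/funext => h /=; rewrite addr0 /GRing.scale/= mulr1.
split=> [[Fd <-]|Fl]; first by rewrite -E; exact: Fd.
by apply: is_derive_cvg; rewrite E.
Qed.

Lemma is_derive_translate (R : realType) (U Z : normedModType R) (f : U -> Z) u b v l :
  is_derive (u + b) v f l -> is_derive u v (fun x => f (x + b)) l.
Proof.
move=> /is_derive_line fl; apply/is_derive_line.
suff -> : (fun h : R => f (u + h *: v + b)) = (fun h : R => f (u + b + h *: v)) by [].
by apply/funext => h; rewrite addrAC.
Qed.

(** The intermediate point is located by [|t| <= |s|], so that both signs of [s] are treated alike
    by the callers. *)
Lemma mvt_line (R : realType) (U : normedModType R) (f : U -> R) u w (s : R) :
  (forall t : R, `|t| <= `|s| -> derivable f (u + t *: w) w) ->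
  exists2 t : R, `|t| <= `|s| &
    f (u + s *: w) - f u = s * 'D_w f (u + t *: w).
Proof.
move=> fd; pose g (t : R) := f (u + t *: w).
have gd (t : R) : `|t| <= `|s| -> is_derive t 1 g ('D_w f (u + t *: w)).
  move=> ts; apply/is_derive_line.
  have /is_derive_line : is_derive (u + t *: w) w f ('D_w f (u + t *: w)).
    by apply: derivableP; exact: fd.
  suff -> : (fun h : R => f (u + t *: w + h *: w)) =
      (fun h : R => g (t + h *: 1)) by [].
  by apply/funext => h; rewrite /g scalerDl addrA /GRing.scale/= mulr1.
have segP (a b : R) : a <= b -> (forall t, a <= t <= b -> `|t| <= `|s|) ->
    exists2 t, a <= t <= b & g b - g a = 'D_w f (u + t *: w) * (b - a).
  move=> ab abs; have [||t] := @MVT_segment _ g (fun t => 'D_w f (u + t *: w)) _ _ ab.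
  - move=> t; rewrite in_itv/= => /andP[/ltW a1 /ltW a2].
    by apply: gd; rewrite abs// a1.
  - apply: derivable_within_continuous => t; rewrite in_itv/= => tab.
    by have [] := gd t (abs _ tab).
  by rewrite in_itv/= => tab gE; exists t.
have [s0|s0] := leP 0 s.
  have [||t /andP[t0 ts] gE] := segP 0 s => //.
    by move=> t /andP[t0 ts]; rewrite !ger0_norm.
  exists t; first by rewrite !ger0_norm.
  by rewrite -/(g s) mulrC -[X in _ * X]subr0 -gE /g scale0r addr0.
have [||t /andP[ts t0] gE] := segP s 0; first exact: ltW.
  by move=> t /andP[ts t0]; rewrite !ler0_norm ?lerN2// ltW.
exists t; first by rewrite !ler0_norm ?lerN2// ltW.
rewrite -/(g s) -[LHS]opprB; have -> : f u = g 0 by rewrite /g scale0r addr0.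
by rewrite gE sub0r mulrN opprK mulrC.
Qed.

Section DifferentialCalculus.
Variables (R : realType) (U : normedModType R) (A V : set U).
Hypothesis AV : relatively_open A V.
Implicit Types f g : U -> R.

Lemma rel_ball f u (e : R) : smooth_on A V f -> A u -> 0 < e ->
  exists2 r : R, 0 < r & forall y, V y -> `|y| < r ->
    A (u + y) /\ `|f (u + y) - f u| <= e.
Proof.
move=> fs Au e0; have [_ _ /(_ u Au) A_near] := AV.
have /cvgrPdist_le/(_ e e0) := smooth_on_cvg fs Au.
rewrite near_withinE => /nbhs0P/nbhs_norm0P[/= r1 r10 f_near].
have /nbhs_norm0P[/= r2 r20 {}A_near] := A_near.
exists (Num.min r1 r2); first by rewrite lt_min r10.
move=> y Vy; rewrite lt_min => /andP[y1 y2].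
have Auy : A (u + y) by exact: A_near.
by split=> //; rewrite distrC; exact: f_near.
Qed.

(** The mean value theorem turns the increment into [s] times a derivative at a point near [u], and
    continuity of ['D_w f] at [u] does the rest. The estimate is uniform in the base point [u + y];
    the chain rule and the second difference depend on this. *)
Lemma increment_bound f u w (e : R) : smooth_on A V f -> A u -> V w -> 0 < e ->
  exists2 r : R, 0 < r & forall y (s : R), V y -> `|y| < r -> `|s *: w| < r ->
    `|f (u + y + s *: w) - f (u + y) - s * 'D_w f u| <= e * `|s|.
Proof.
move=> fs Au Vw e0.
have [r r0 rP] := rel_ball (smooth_on_derive fs Vw) Au e0.
exists (r / 2); first by rewrite divr_gt0.
move=> y s Vy yr sr.
have tP (t : R) : `|t| <= `|s| -> V (y + t *: w) /\ `|y + t *: w| < r.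
  move=> ts; split.
    by rewrite addrC; have [_ Vl _] := AV; exact: Vl.
  rewrite (le_lt_trans (ler_normD _ _))// [r]splitr ltrD//.
  by rewrite (le_lt_trans _ sr)// !normrZ ler_wpM2r.
have [t /tP[Vt tr] ->] : exists2 t : R, `|t| <= `|s| &
    f (u + y + s *: w) - f (u + y) = s * 'D_w f (u + y + t *: w).
  apply: mvt_line => t /tP[Vt tr]; rewrite -addrA.
  have [_ fd _] := (smooth_onP A V f).1 fs; apply: fd => //.
  by have [] := rP _ Vt tr.
rewrite -mulrBr normrM mulrC ler_wpM2r// -addrA.
by have [] := rP _ Vt tr.
Qed.

(** The base point [u + Y h] moves with [h], because increments in other directions have been made
    before; the uniformity of [increment_bound] absorbs the motion. *)
Lemma chain_step f u w (Y : R -> U) (a : R -> R) (a' : R) :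
  smooth_on A V f -> A u -> V w -> (forall h, V (Y h)) ->
  Y @ (0 : R) --> (0 : U) -> a 0 = 0 -> is_derive (0 : R) (1 : R) a a' ->
  (fun h => h^-1 * (f (u + Y h + a h *: w) - f (u + Y h))) @ 0^' -->
  a' * 'D_w f u.
Proof.
move=> fs Au Vw VY Y0 a0 aD.
have aq : (fun h => h^-1 * a h) @ 0^' --> a'.
  by have /is_derive0P := aD; rewrite a0; under eq_fun do rewrite subr0.
have ac : a @ (0 : R) --> (0 : R).
  rewrite -[X in _ --> X]a0; apply: differentiable_continuous.
  by apply/derivable1_diffP; case: aD.
have awc : (fun h => a h *: w) @ (0 : R) --> (0 : U).
  by rewrite -[X in _ --> X](scale0r w); exact: cvgZl.
pose rem h := h^-1 * (f (u + Y h + a h *: w) - f (u + Y h) - a h * 'D_w f u).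
have -> : (fun h => h^-1 * (f (u + Y h + a h *: w) - f (u + Y h))) =
    (fun h => h^-1 * a h * 'D_w f u + rem h).
  by apply/funext => h; rewrite /rem; ring.
rewrite -[X in _ --> X]addr0; apply: cvgD; first exact: cvgMl.
apply/cvgrPdist_le => e e0.
(* For small [h] the quotient of [a h] by [h] is within 1 of [a'], so |a h| <= (|a'| + 1) |h|, and
   this choice leaves a total error of at most [e]. *)
have e1 : 0 < e / (`|a'| + 1) by rewrite divr_gt0// ltr_wpDl.
have [r r0 rP] := increment_bound fs Au Vw e1.
near=> h; rewrite sub0r normrN /rem normrM.
have -> : `|h^-1| = `|h|^-1 by rewrite normfV.
have h0 : 0 < `|h|.
  by rewrite normr_gt0; near: h; exact: nbhs_dnbhs_neq.
rewrite ler_pdivrMl// (le_trans (rP _ _ (VY h) _ _))//.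
- near: h; apply: nbhs_dnbhs.
  by move/cvgr0Pnorm_lt : Y0; exact.
- near: h; apply: nbhs_dnbhs.
  by move/cvgr0Pnorm_lt : awc; exact.
rewrite mulrAC -mulrA [leRHS]mulrC ler_wpM2l ?(ltW e0)//.
rewrite ler_pdivrMr ?ltr_wpDl// -ler_pdivrMl//.
have : `|h^-1 * a h - a'| <= 1.
  rewrite distrC; near: h; move/cvgrPdist_le : aq; apply; exact: ltr01.
rewrite -[`|h|^-1]normfV -normrM => ha.
rewrite -[X in `|X|](subrK a') (le_trans (ler_normD _ _))// addrC lerD//.
Unshelve. all: by end_near. Qed.

(** The coordinates are changed one at a time: the increment telescopes along the list, and
    [chain_step] gives the limit of each summand. *)
Lemma chain_frame f u (I : Type) (r : seq I) (a : I -> R -> R) (a' : I -> R)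
    (e : I -> U) : smooth_on A V f -> A u -> (forall i, V (e i)) ->
  (forall i, a i 0 = 0) -> (forall i, is_derive (0 : R) (1 : R) (a i) (a' i)) ->
  is_derive (0 : R) (1 : R) (fun h => f (u + \sum_(i <- r) a i h *: e i))
    (\sum_(i <- r) a' i * 'D_(e i) f u).
Proof.
move=> fs Au Ve a0 aD; elim: r => [|i r /is_derive0P IH].
  by under eq_fun do rewrite big_nil; rewrite big_nil; exact: is_derive_cst.
apply/is_derive0P; rewrite [X in _ --> X]big_cons.
set Y := fun h => \sum_(i <- r) a i h *: e i.
have Y0 : Y 0 = 0 by rewrite /Y big1// => j _; rewrite a0 scale0r.
have -> : (fun h => h^-1 *: (f (u + \sum_(j <- i :: r) a j h *: e j) -
      f (u + \sum_(j <- i :: r) a j 0 *: e j))) =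
    (fun h => h^-1 * (f (u + Y h + a i h *: e i) - f (u + Y h)) +
       h^-1 *: (f (u + Y h) - f (u + Y 0))).
  apply/funext => h; rewrite !big_cons -/(Y h) -/(Y 0) Y0 a0 scale0r !addr0.
  by rewrite /GRing.scale/= [a i h *: e i + _]addrC addrA -mulrDr addrA subrK.
apply: cvgD IH; apply: chain_step => //.
  by move=> h; apply: (dirs_sum AV) => j _; exact: (dirs_scale AV).
rewrite -[X in _ --> X]Y0; apply: cvgr_sum => j _; apply: cvgZl.
rewrite a0 -[X in _ --> X](a0 j); apply: differentiable_continuous.
by apply/derivable1_diffP; case: (aD j).
Qed.

(** Mere existence of directional derivatives would not make them linear in the direction. Their
    continuity does, through [chain_frame] on the straight curve with coordinates [h * a i]. *)
Lemma derive_comb f u (I : Type) (r : seq I) (a : I -> R) (e : I -> U) :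
  smooth_on A V f -> A u -> (forall i, V (e i)) ->
  'D_(\sum_(i <- r) a i *: e i) f u = \sum_(i <- r) a i * 'D_(e i) f u.
Proof.
move=> fs Au Ve; apply: (@derive_val _ _ _ u); apply/is_derive_line.
have := chain_frame r (a := fun i h => h * a i) (a' := a) fs Au Ve.
have -> : (fun h => f (u + \sum_(i <- r) h * a i *: e i)) =
    (fun h => f (u + h *: \sum_(i <- r) a i *: e i)).
  apply/funext => h; rewrite scaler_sumr; congr (f (_ + _)).
  by apply: eq_bigr => i _; rewrite scalerA.
apply=> i; first by rewrite mul0r.
have := is_derive_scale_vec (a i : R) (is_derive_id (0 : R) (1 : R)).
by rewrite /GRing.scale/= mul1r.
Qed.

Lemma derive_lin f u (a : R) v w : smooth_on A V f -> A u -> V v -> V w ->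
  'D_(a *: v + w) f u = a * 'D_v f u + 'D_w f u.
Proof.
move=> fs Au Vv Vw.
have := derive_comb [:: true; false] (fun b => if b then a else 1)
  (e := fun b => if b then v else w) fs Au.
by rewrite !big_cons !big_nil !addr0 scale1r mul1r; apply; case.
Qed.

(** The mean value theorem in direction [v], applied to the map sending x to f (x + h w) - f x,
    leaves an increment of ['D_v f] along [w], which [increment_bound] controls. The difference is
    symmetric in [v] and [w], whence [derive_sym]. *)
Lemma second_difference f u v w : smooth_on A V f -> A u -> V v -> V w ->
  (fun h : R => h^-1 * h^-1 * (f (u + h *: v + h *: w) - f (u + h *: v) -
    (f (u + h *: w) - f u))) @ 0^' --> 'D_w ('D_v f) u.
Proof.
move=> fs Au Vv Vw; apply/cvgrPdist_le => e e0.
have fvs := smooth_on_derive fs Vv.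
have [r r0 rP] := increment_bound fvs Au Vw e0.
have [s s0 sP] := rel_ball fs Au ltr01.
have near0 x (c : R) : 0 < c -> \forall h \near (0 : R), `|h *: x : U| < c.
  have : (fun h : R => h *: x) @ (0 : R) --> (0 : U).
    by rewrite -[X in _ --> X](scale0r x); apply: cvgZl; exact: cvg_id.
  by move/cvgr0Pnorm_lt; exact.
near=> h.
have h0 : 0 < `|h|.
  by rewrite normr_gt0; near: h; exact: nbhs_dnbhs_neq.
have hn0 : h != 0 by rewrite -normr_gt0.
have hvr : `|h *: v| < r by near: h; apply: nbhs_dnbhs; exact: near0.
have hwr : `|h *: w| < r by near: h; apply: nbhs_dnbhs; exact: near0.
have hvs : `|h *: v| < s / 2.
  by near: h; apply: nbhs_dnbhs; apply: near0; rewrite divr_gt0.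
have hws : `|h *: w| < s / 2.
  by near: h; apply: nbhs_dnbhs; apply: near0; rewrite divr_gt0.
have tr (t : R) c : `|t| <= `|h| -> `|h *: v| < c -> `|t *: v| < c.
  by move=> th; apply: le_lt_trans; rewrite !normrZ ler_wpM2r.
have Vl := dirs_scale AV.
have fd x : A x -> is_derive x v f ('D_v f x).
  by move=> Ax; exact: smooth_on_is_derive fs Ax Vv.
have gd (t : R) : `|t| <= `|h| -> is_derive (u + t *: v) v
    (fun x => f (x + h *: w) - f x)
    ('D_v f (u + t *: v + h *: w) - 'D_v f (u + t *: v)).
  move=> th; have tv : `|t *: v| < s / 2 by exact: tr.
  apply: is_deriveB; last first.
    apply: fd; have [] // := sP (t *: v) (Vl _ _ Vv).
    by rewrite (lt_trans tv)// ltr_pdivrMr// ltr_pMr// ltr1n.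
  apply: is_derive_translate; apply: fd; rewrite -addrA.
  have [] // := sP (t *: v + h *: w).
    by have [_ Vlin _] := AV; apply: Vlin => //; exact: Vl.
  by rewrite (le_lt_trans (ler_normD _ _))// [s]splitr ltrD.
have [t th gE] : exists2 t : R, `|t| <= `|h| &
    (f (u + h *: v + h *: w) - f (u + h *: v)) - (f (u + h *: w) - f u) =
    h * 'D_v (fun x => f (x + h *: w) - f x) (u + t *: v).
  by apply: (mvt_line (f := fun x => f (x + h *: w) - f x)) => t /gd[].
rewrite gE (gd t th).(derive_val).
have := rP _ h (Vl t _ Vv) (tr _ _ th hvr) hwr.
set D := 'D_w _ u; set B := 'D_v f _ - _ => BD.
have -> : D - h^-1 * h^-1 * (h * B) = - (h^-1 * (B - h * D)) by field.
by rewrite normrN normrM normfV ler_pdivrMl// [leRHS]mulrC.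
Unshelve. all: by end_near. Qed.

Lemma derive_sym f u v w : smooth_on A V f -> A u -> V v -> V w ->
  'D_w ('D_v f) u = 'D_v ('D_w f) u.
Proof.
move=> fs Au Vv Vw; have vw := second_difference fs Au Vv Vw.
have wv := second_difference fs Au Vw Vv.
apply: (cvg_unique _ vw); first exact: norm_hausdorff.
move: wv => /=; under eq_fun => h.
  have -> : f (u + h *: w + h *: v) - f (u + h *: w) - (f (u + h *: v) - f u) =
    f (u + h *: v + h *: w) - f (u + h *: v) - (f (u + h *: w) - f u).
    by rewrite (addrAC u (h *: w)); ring.
  over.
by [].
Qed.

End DifferentialCalculus.

(* A basis [e] of the subspace [V] together with its coordinate forms,
   extended to linear forms on the whole space. *)
Record frame (R : realType) (U : normedModType R) (V : set U) (n : nat)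
    (e : 'I_n -> U) (k : 'I_n -> U -> R) : Prop := Frame {
  frame_mem : forall i, V (e i);
  frame_lin : forall i, linear_map (k i);
  frame_cont : forall i, continuous (k i);
  frame_decomp : forall v, V v -> v = \sum_i k i v *: e i;
  frame_coord : forall (a : 'I_n -> R) j, k j (\sum_i a i *: e i) = a j }.

Lemma linear_mx_continuous (R : realType) (m n : nat) (c : 'M[R]_(m, n) -> R) :
  linear_map c -> continuous c.
Proof.
move=> c_lin; have -> : c = fun v => \sum_i \sum_j v i j * c (delta_mx i j).
  apply/funext => v; rewrite [in LHS](matrix_sum_delta v) (linear_map_sum c_lin).
  apply: eq_bigr => i _; rewrite (linear_map_sum c_lin).
  by apply: eq_bigr => j _; rewrite (linear_mapZ c_lin).
move=> v; have FF := nbhs_filter (v : 'M[R]_(m, n)).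
apply: cvgr_sum => i _; apply: cvgr_sum => j _; apply: cvgMl.
exact: coord_continuous.
Qed.

(** [V] is a bare set closed under linear combinations, so a vector space of maximal dimension
    inside it is taken; by maximality, adjoining an element of [V] does not enlarge it. *)
Lemma frame_exists (R : realType) (p q : nat) (V : set 'M[R]_(p, q)) :
  V 0 -> (forall (a : R) u v, V u -> V v -> V (a *: u + v)) ->
  exists n (e : 'I_n -> 'M[R]_(p, q)) k, frame V e k.
Proof.
move=> V0 V_lin.
pose P n := `[< exists2 W : {vspace 'M[R]_(p, q)}, \dim W = n &
  forall v, v \in W -> V v >].
have P0 : exists n, P n.
  exists 0%N; apply/asboolP; exists 0%VS; first exact: dimv0.
  by move=> v; rewrite memv0 => /eqP ->.
have Pmax n : P n -> (n <= \dim {:'M[R]_(p, q)})%N.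
  by move=> /asboolP[W <- _]; exact: dimvS (subvf W).
have [n /asboolP[W Wn WV] nmax] := ex_maxnP P0 Pmax.
have VW v : V v -> v \in W.
  move=> Vv; have WW' : (W <= W + <[v]>)%VS by exact: addvSl.
  have /eqP -> : (W == W + <[v]>)%VS.
    rewrite eqEdim WW' Wn; apply: nmax; apply/asboolP.
    exists (W + <[v]>)%VS => // _ /memv_addP[x xW [_ /vlineP[a ->] ->]].
    by rewrite addrC; apply: V_lin => //; exact: WV.
  by rewrite (subvP (addvSr _ _))// memv_line.
exists (\dim W), (fun i => (vbasis W)`_i), (fun i v => coord (vbasis W) i v).
have k_lin i : linear_map (fun v => coord (vbasis W) i v : R).
  by move=> a u v; rewrite linearP.
split=> //.
- by move=> i; apply/WV/vbasis_mem/mem_nth; rewrite size_tuple.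
- by move=> i; exact: linear_mx_continuous.
- by move=> v /VW /coord_vbasis.
by move=> a j; rewrite coord_sum_free//; exact: basis_free (vbasisP W).
Qed.

(** * Chain rule for curves in a slice and for compositions *)

Section ChainRule.
Variables (R : realType) (U : normedModType R) (A V : set U).
Hypothesis AV : relatively_open A V.
Variables (n : nat) (e : 'I_n -> U) (k : 'I_n -> U -> R).
Hypothesis ek : frame V e k.

Lemma derive_coord i (c : R -> U) c' : is_derive (0 : R) (1 : R) c c' ->
  is_derive (0 : R) (1 : R) (fun h => k i (c h - c 0)) (k i c').
Proof.
move=> cd; apply: (is_derive_comp_linear (frame_lin ek i) (frame_cont ek (i := i))
  (f := fun h => c h - c 0)).
by rewrite -[c']subr0; apply: is_deriveB; exact: is_derive_cst.
Qed.

Lemma curve_decomp (c : R -> U) : (\forall h \near 0, V (c h - c 0)) ->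
  \forall h \near 0, c h = c 0 + \sum_i k i (c h - c 0) *: e i.
Proof. by apply: filterS => h /(frame_decomp ek) <-; rewrite addrC subrK. Qed.

(** Near 0 the curve equals its frame expansion, and the coordinate forms are continuous, so the
    expansion can be differentiated termwise. In particular the velocity does not leave [V]. *)
Lemma velocity_decomp (c : R -> U) c' : (\forall h \near 0, V (c h - c 0)) ->
  is_derive (0 : R) (1 : R) c c' -> c' = \sum_i k i c' *: e i.
Proof.
move=> Vc cd; have cE := curve_decomp Vc.
have sumD : is_derive (0 : R) (1 : R)
    (fun h => c 0 + \sum_i k i (c h - c 0) *: e i) (0 + \sum_i k i c' *: e i).
  apply: is_deriveD; apply: is_derive_bigsum => i _; apply: is_derive_scale_vec.
  exact: derive_coord.
have : is_derive (0 : R) (1 : R) c (0 + \sum_i k i c' *: e i).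
  by apply: near_eq_is_derive sumD; near do apply/esym.
by rewrite add0r => -[_ <-]; case: cd => _ ->.
Unshelve. all: by end_near. Qed.

Lemma velocity_mem (c : R -> U) c' : (\forall h \near 0, V (c h - c 0)) ->
  is_derive (0 : R) (1 : R) c c' -> V c'.
Proof.
move=> Vc cd; rewrite (velocity_decomp Vc cd).
apply: (dirs_sum AV) => i _; apply: (dirs_scale AV); exact: (frame_mem ek).
Qed.

Lemma chain_curve (f : U -> R) (c : R -> U) c' : smooth_on A V f -> A (c 0) ->
  (\forall h \near 0, V (c h - c 0)) -> is_derive (0 : R) (1 : R) c c' ->
  is_derive (0 : R) (1 : R) (f \o c) ('D_c' f (c 0)).
Proof.
move=> fs Ac Vc cd; have cE := curve_decomp Vc; have Ve := frame_mem ek.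
rewrite {1}(velocity_decomp Vc cd) (derive_comb AV _ _ fs Ac Ve).
have a0 i : k i (c 0 - c 0) = 0 by rewrite subrr (linear_map0 (frame_lin ek i)).
have aD i := derive_coord i cd.
apply: near_eq_is_derive (chain_frame AV (index_enum 'I_n) fs Ac Ve a0 aD).
by near=> h; rewrite /=; congr f; apply/esym; near: h.
Unshelve. all: by end_near. Qed.

End ChainRule.

Lemma relatively_openT (R : realType) (U : normedModType R) :
  relatively_open (@setT U) (@setT U).
Proof. by split=> // u _; exact: nearW. Qed.

Section Composition.
Variables (R : realType) (U W : normedModType R) (A V : set U).
Hypothesis AV : relatively_open A V.
Variables (n : nat) (e : 'I_n -> W) (k : 'I_n -> W -> R).
Hypothesis ek : frame setT e k.
Variable t : U -> W.
Hypothesis ts : smooth_on A V t.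

Lemma is_derive_comp (f : W -> R) u v l : smooth_on setT setT f ->
  is_derive u v t l -> is_derive u v (f \o t) ('D_l f (t u)).
Proof.
move=> fs /is_derive_line tl; apply/is_derive_line.
have near_dirs : \forall h \near (0 : R), setT (t (u + h *: v) - t (u + 0 *: v)).
  by near=> h; exact: I.
have := chain_curve (relatively_openT W) ek fs
  (c := fun h : R => t (u + h *: v)) I near_dirs tl.
by rewrite scale0r addr0.
Unshelve. all: by end_near. Qed.

(** By the chain rule the derivative of [f \o t] is a sum of products of a smooth function with some
    [g \o t]; this is the closure that [smooth_on_coind] asks for. *)
Inductive comp_term : (U -> R) -> Prop :=
| CompBase f of smooth_on A V f : comp_term f
| CompSmooth f of smooth_on setT setT f : comp_term (f \o t)
| CompAdd f g of comp_term f & comp_term g : comp_term (fun u => f u + g u)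
| CompMul f g of comp_term f & comp_term g : comp_term (fun u => f u * g u).

Lemma comp_term_sum (I : Type) (r : seq I) (f : I -> U -> R) :
  (forall i, comp_term (f i)) -> comp_term (fun u => \sum_(i <- r) f i u).
Proof.
move=> fc; elim: r => [|i r IH].
  by under eq_fun do rewrite big_nil; apply: CompBase; exact: smooth_on_cst.
by under eq_fun do rewrite big_cons; exact: CompAdd.
Qed.

Lemma smooth_on_comp (f : W -> R) : smooth_on setT setT f -> smooth_on A V (f \o t).
Proof.
move=> fs; apply: (smooth_on_coind AV (P := comp_term)); last exact: CompSmooth.
move=> {fs f} g; elim=> {g}
  [f fs|f fs|f g _ [fc fd] _ [gc gd]|f g fs [fc fd] gs [gc gd]].
- have [fc _ _] := (smooth_onP A V f).1 fs; split=> // v Vv; exists ('D_v f).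
    by apply: CompBase; exact: smooth_on_derive.
  by move=> u Au; exact: (smooth_on_is_derive fs Au Vv).
- split=> [|v Vv].
    apply/subspace_continuousP => u Au.
    have fc : f @ nbhs (t u) --> f (t u).
      have fc := smooth_on_cvg fs (I : setT (t u)).
      apply: cvg_trans fc; apply: cvg_app => P wP; near=> x.
      have : setT x -> P x by near: x; exact: wP.
      exact.
    exact: cvg_comp (smooth_on_cvg ts Au) fc.
  exists (fun u => \sum_i (k i \o 'D_v t) u * ('D_(e i) f \o t) u).
    apply: comp_term_sum => i; apply: CompMul; last first.
      by apply: CompSmooth; exact: smooth_on_derive.
    apply: CompBase; apply: (smooth_on_comp_linear AV (frame_lin ek i)).
      exact: (frame_cont ek).
    exact: smooth_on_derive.
  move=> u Au; have := is_derive_comp fs (smooth_on_is_derive ts Au Vv).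
  rewrite [in X in X -> _](frame_decomp ek (I : setT ('D_v t u))).
  rewrite (derive_comb (relatively_openT W) _ _ fs (I : setT (t u)) (fun=> I)).
  by [].
- split=> [|v Vv].
    by move/subspace_continuousP in fc; move/subspace_continuousP in gc;
       apply/subspace_continuousP => u Au; apply: cvgD; [exact: fc|exact: gc].
  have [f' sf' ff'] := fd _ Vv; have [g' sg' gg'] := gd _ Vv.
  exists (fun u => f' u + g' u); first exact: CompAdd.
  by move=> u Au; apply: is_deriveD; [exact: ff'|exact: gg'].
split=> [|v Vv].
  by move/subspace_continuousP in fc; move/subspace_continuousP in gc;
     apply/subspace_continuousP => u Au; apply: cvgM; [exact: fc|exact: gc].
have [f' sf' ff'] := fd _ Vv; have [g' sg' gg'] := gd _ Vv.
exists (fun u => f' u * g u + f u * g' u).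
  by apply: CompAdd; exact: CompMul.
by move=> u Au; apply: is_derive_mul; [exact: ff'|exact: gg'].
Unshelve. all: by end_near. Qed.

End Composition.

(** * Flat connections in coordinates *)

Section CoordinateFields.
Variables (R : realType) (U : normedModType R) (A V : set U).
Hypothesis AV : relatively_open A V.
Variables (n : nat) (e : 'I_n -> U) (k : 'I_n -> U -> R).
Hypothesis ek : frame V e k.
Implicit Types (f : U -> R) (X Y Z F : U -> U).

Definition coord_field F := smooth_on A V F /\ forall u, A u -> V (F u).

Lemma frame_inj v w : V v -> V w -> (forall j, k j v = k j w) -> v = w.
Proof.
move=> Vv Vw vw; rewrite (frame_decomp ek Vv) (frame_decomp ek Vw).
by apply: eq_bigr => i _; rewrite vw.
Qed.

Lemma frame_comb_mem (a : 'I_n -> R) : V (\sum_i a i *: e i).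
Proof.
by apply: (dirs_sum AV) => i _; apply: (dirs_scale AV); exact: (frame_mem ek).
Qed.

Lemma dirs_sub u v : V u -> V v -> V (u - v).
Proof. by move=> Vu Vv; have [_ Vl _] := AV; rewrite addrC -scaleN1r; exact: Vl. Qed.

Lemma coord_field_coord F i : coord_field F -> smooth_on A V (k i \o F).
Proof.
move=> [Fs _]; apply: smooth_on_comp_linear => //.
  exact: (frame_lin ek).
exact: (frame_cont ek).
Qed.

Lemma eq_on_coord_field F F' :
  (forall u, A u -> F u = F' u) -> coord_field F -> coord_field F'.
Proof.
move=> FF' [Fs FV]; split; first exact: eq_on_smooth Fs.
by move=> u Au; rewrite -FF'//; exact: FV.
Qed.

Lemma coord_field_comb (a : 'I_n -> U -> R) :
  (forall i, smooth_on A V (a i)) -> coord_field (fun u => \sum_i a i u *: e i).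
Proof.
by move=> sa; split; [exact: smooth_on_comb|move=> u _; exact: frame_comb_mem].
Qed.

Lemma derive_field_coord F u v j : coord_field F -> A u -> V v ->
  k j ('D_v F u) = 'D_v (k j \o F) u.
Proof.
move=> [Fs _] Au Vv; apply/esym/(@derive_val _ _ _ u).
apply: (is_derive_comp_linear (frame_lin ek j)); first exact: (frame_cont ek).
exact: (smooth_on_is_derive Fs Au Vv).
Qed.

Lemma derive_field F u v : coord_field F -> A u -> V v ->
  'D_v F u = \sum_j 'D_v (k j \o F) u *: e j.
Proof.
move=> cF Au Vv; have [Fs FV] := cF.
rewrite (@eq_on_derive _ _ _ _ AV _ F (fun x => \sum_j (k j \o F) x *: e j))//.
  apply: (@derive_val _ _ _ u); apply: is_derive_bigsum => j _.
  apply: is_derive_scale_vec.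
  exact: (smooth_on_is_derive (coord_field_coord j cF) Au Vv).
by move=> x Ax; apply: (frame_decomp ek); exact: FV.
Qed.

Lemma derive_field_mem F u v : coord_field F -> A u -> V v -> V ('D_v F u).
Proof. by move=> cF Au Vv; rewrite derive_field//; exact: frame_comb_mem. Qed.

Lemma derive_expand f u v : smooth_on A V f -> A u -> V v ->
  'D_v f u = \sum_i k i v * 'D_(e i) f u.
Proof.
move=> fs Au Vv; rewrite [in LHS](frame_decomp ek Vv) (derive_comb AV)//.
exact: (frame_mem ek).
Qed.

(** The direction varies with the point; the frame expansion leaves constant directions with smooth
    coefficients. *)
Lemma smooth_derive_along f X : smooth_on A V f -> coord_field X ->
  smooth_on A V (fun x => 'D_(X x) f x).
Proof.
move=> fs cX; have [Xs XV] := cX.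
apply: (eq_on_smooth AV (f := fun x => \sum_i (k i \o X) x * 'D_(e i) f x)).
  by move=> x Ax; rewrite [RHS]derive_expand//; exact: XV.
apply: (smooth_on_sum AV) => i _; apply: (smooth_on_mul AV).
  exact: coord_field_coord.
by apply: smooth_on_derive => //; exact: (frame_mem ek).
Qed.

Lemma derive_derive_along f Y u v : smooth_on A V f -> coord_field Y ->
  A u -> V v -> 'D_v (fun x => 'D_(Y x) f x) u =
    'D_('D_v Y u) f u + 'D_(Y u) ('D_v f) u.
Proof.
move=> fs cY Au Vv; have [Ys YV] := cY; have Ve := frame_mem ek.
rewrite (@eq_on_derive _ _ _ _ AV _ (fun x => 'D_(Y x) f x)
  (fun x => \sum_i (k i \o Y) x * 'D_(e i) f x))//; last first.
  by move=> x Ax; rewrite [LHS]derive_expand//; exact: YV.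
transitivity (\sum_i ('D_v (k i \o Y) u * 'D_(e i) f u +
    (k i \o Y) u * 'D_v ('D_(e i) f) u)).
  apply: (@derive_val _ _ _ u); apply: is_derive_bigsum => i _.
  apply: is_derive_mul.
    exact: (smooth_on_is_derive (coord_field_coord i cY) Au Vv).
  exact: (smooth_on_is_derive (smooth_on_derive fs (Ve i)) Au Vv).
rewrite big_split/=; congr (_ + _).
  rewrite [RHS]derive_expand//; last exact: derive_field_mem.
  by apply: eq_bigr => i _; rewrite derive_field_coord.
rewrite [RHS](derive_expand (smooth_on_derive fs Vv) Au (YV u Au)).
by apply: eq_bigr => i _; rewrite (derive_sym AV fs Au (Ve i) Vv).
Qed.

(** The second-order terms cancel by [derive_sym]. *)
Lemma commutator f X Y u : smooth_on A V f -> coord_field X -> coord_field Y ->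
  A u -> 'D_(X u) (fun x => 'D_(Y x) f x) u - 'D_(Y u) (fun x => 'D_(X x) f x) u =
    'D_('D_(X u) Y u - 'D_(Y u) X u) f u.
Proof.
move=> fs cX cY Au; have [_ /(_ u Au) VX] := cX; have [_ /(_ u Au) VY] := cY.
rewrite (derive_derive_along fs cY Au VX) (derive_derive_along fs cX Au VY).
rewrite (derive_sym AV fs Au VX VY).
have VDY := derive_field_mem cY Au VX; have VDX := derive_field_mem cX Au VY.
have -> : 'D_(X u) Y u - 'D_(Y u) X u = -1 *: 'D_(Y u) X u + 'D_(X u) Y u.
  by rewrite scaleN1r addrC.
apply: etrans _ (esym (derive_lin AV (-1) fs Au VDX VDY)).
have cancel_c (a b c : R) : a + c - (b + c) = -1 * b + a by ring.
exact: cancel_c.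
Qed.

(** A flat torsion-free connection read in the chart. The differentiating argument is a single
    vector, which builds in tensoriality; the bracket of two fields is written out in coordinates.
    The chart connection and its dual are both instances, so the passage to manifolds is made
    once. *)
Record flat_operator (Op : U -> (U -> U) -> U -> U) : Prop := FlatOperator {
  op_field : forall X Y, coord_field X -> coord_field Y ->
    coord_field (fun u => Op (X u) Y u);
  op_eq : forall v Y Y' u, coord_field Y -> coord_field Y' ->
    (forall x, A x -> Y x = Y' x) -> A u -> V v -> Op v Y u = Op v Y' u;
  op_lin : forall (a : R) v v' Y u, coord_field Y -> A u -> V v -> V v' ->
    Op (a *: v + v') Y u = a *: Op v Y u + Op v' Y u;
  op_leibniz : forall f v Y Y' u, smooth_on A V f -> coord_field Y ->
    coord_field Y' -> A u -> V v -> Op v (fun x => f x *: Y x + Y' x) u =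
      'D_v f u *: Y u + f u *: Op v Y u + Op v Y' u;
  op_torsion : forall X Y u, coord_field X -> coord_field Y -> A u ->
    Op (X u) Y u - Op (Y u) X u = 'D_(X u) Y u - 'D_(Y u) X u;
  op_flat : forall X Y Z u, coord_field X -> coord_field Y -> coord_field Z ->
    A u -> Op (X u) (fun x => Op (Y x) Z x) u - Op (Y u) (fun x => Op (X x) Z x) u =
      Op ('D_(X u) Y u - 'D_(Y u) X u) Z u }.

Lemma coord_field_scale_add f Y Y' : smooth_on A V f -> coord_field Y ->
  coord_field Y' -> coord_field (fun x => f x *: Y x + Y' x).
Proof.
move=> fs cY cY'; have [_ VY] := cY; have [_ VY'] := cY'.
apply: (@eq_on_coord_field (fun x =>
    \sum_i (f x * (k i \o Y) x + (k i \o Y') x) *: e i)); last first.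
  apply: coord_field_comb => i; apply: (smooth_on_add AV).
    exact: (smooth_on_mul AV fs (coord_field_coord i cY)).
  exact: coord_field_coord.
move=> x Ax; rewrite [Y x in RHS](frame_decomp ek (VY x Ax)).
rewrite [Y' x in RHS](frame_decomp ek (VY' x Ax)) scaler_sumr -big_split/=.
by apply: eq_bigr => i _; rewrite scalerDl scalerA.
Qed.

(** The clauses reduce to the scalar functions [k j \o Y]; flatness is [commutator] applied to each
    of them. *)
Lemma derive_flat_operator : flat_operator (fun v Y u => 'D_v Y u).
Proof.
have fieldP X Y : coord_field X -> coord_field Y ->
    coord_field (fun u => 'D_(X u) Y u).
  move=> cX cY; have [_ VX] := cX.
  apply: (@eq_on_coord_field (fun u => \sum_j 'D_(X u) (k j \o Y) u *: e j)).
    by move=> u Au; rewrite derive_field//; exact: VX.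
  by apply: coord_field_comb => j; apply: smooth_derive_along => //;
     exact: coord_field_coord.
split=> //.
- by move=> v Y Y' u _ _ YY' Au Vv; exact: (eq_on_derive AV).
- move=> a v v' Y u cY Au Vv Vv'; have [_ Vl _] := AV.
  rewrite !derive_field//; last exact: Vl.
  rewrite scaler_sumr -big_split/=; apply: eq_bigr => j _.
  by rewrite (derive_lin AV)// ?scalerDl ?scalerA//; exact: coord_field_coord.
- move=> f v Y Y' u fs cY cY' Au Vv; have [_ Vl _] := AV.
  have [_ /(_ u Au) VY] := cY.
  apply: frame_inj.
  + by apply: derive_field_mem => //; exact: coord_field_scale_add.
  + by rewrite -addrA; apply: (Vl) => //; apply: (Vl); exact: derive_field_mem.
  move=> j; have kj := frame_lin ek j.
  rewrite derive_field_coord//; last exact: coord_field_scale_add.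
  rewrite -addrA !kj !derive_field_coord//.
  apply: (@derive_val _ _ _ u).
  have -> : k j \o (fun x => f x *: Y x + Y' x) =
      fun x => f x * (k j \o Y) x + (k j \o Y') x.
    by apply/funext => x; rewrite /= kj.
  rewrite addrA; apply: is_deriveD; last first.
    exact: (smooth_on_is_derive (coord_field_coord j cY') Au Vv).
  apply: is_derive_mul; first exact: (smooth_on_is_derive fs Au Vv).
  exact: (smooth_on_is_derive (coord_field_coord j cY) Au Vv).
move=> X Y Z u cX cY cZ Au; have [_ VX] := cX; have [_ VY] := cY.
have cXZ := fieldP _ _ cX cZ; have cYZ := fieldP _ _ cY cZ.
have Vb : V ('D_(X u) Y u - 'D_(Y u) X u).
  by apply: dirs_sub; apply: derive_field_mem => //; [exact: VX|exact: VY].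
apply: frame_inj.
- by apply: dirs_sub; apply: derive_field_mem => //; [exact: VX|exact: VY].
- exact: derive_field_mem.
move=> j; rewrite (linear_mapB (frame_lin ek j)).
rewrite !derive_field_coord//; [|exact: VY|exact: VX].
have kD (W : U -> U) : coord_field W -> forall x, A x ->
    (k j \o (fun x => 'D_(W x) Z x)) x = 'D_(W x) (k j \o Z) x.
  by move=> [_ VW] x Ax; rewrite /= derive_field_coord//; exact: VW.
rewrite (eq_on_derive AV (kD _ cY) Au (VX _ Au)).
rewrite (eq_on_derive AV (kD _ cX) Au (VY _ Au)).
by rewrite commutator//; exact: coord_field_coord.
Qed.

End CoordinateFields.

(** * The connection dual to the flat one *)

Lemma smooth_on_det (R : realType) (U : normedModType R) (A V : set U) p
    (M : U -> 'M[R]_p) : relatively_open A V ->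
  (forall i j, smooth_on A V (fun u => M u i j)) ->
  smooth_on A V (fun u => \det (M u)).
Proof.
move=> AV Ms; apply: (smooth_on_sum AV) => s _; apply: (smooth_on_mul AV).
  exact: (@smooth_on_cst R U A V AV R _).
by apply: (smooth_on_prod AV) => i _; exact: Ms.
Qed.

Lemma smooth_on_invmx (R : realType) (U : normedModType R) (A V : set U) p
    (M : U -> 'M[R]_p) : relatively_open A V ->
  (forall u, A u -> M u \in unitmx) ->
  (forall i j, smooth_on A V (fun u => M u i j)) ->
  forall i j, smooth_on A V (fun u => invmx (M u) i j).
Proof.
move=> AV Munit Ms i j.
apply: (eq_on_smooth AV (f := fun u => (\det (M u))^-1 * cofactor (M u) j i)).
  by move=> u Au; rewrite /invmx Munit// !mxE.
apply: (smooth_on_mul AV).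
  apply: (smooth_on_inv AV); first exact: smooth_on_det.
  by move=> u /Munit; rewrite unitmxE unitfE.
apply: (smooth_on_mul AV); first exact: (@smooth_on_cst R U A V AV R _).
apply: smooth_on_det => // a b.
by apply: (eq_on_smooth AV) (Ms (lift j a) (lift i b)) => u _; rewrite !mxE.
Qed.

(* The second derivatives and the dual connection are locked, because unifying
   two distinct instances would otherwise unfold the limits defining them. *)
HB.lock Definition hess (R : realType) (U : normedModType R) (phi : U -> R)
  (u y z : U) : R := hessian phi u y z.

Lemma hessian_hess (R : realType) (U : normedModType R) (phi : U -> R) u y z :
  hessian phi u y z = hess phi u y z.
Proof. by rewrite hess.unlock. Qed.

(** The field [Z] with its index lowered by the Hessian metric, paired with the constant [y]. In
    these components the dual connection is plain differentiation. *)
Definition covector (R : realType) (U : normedModType R) (phi : U -> R) y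
  (Z : U -> U) : U -> R := fun x => hess phi x y (Z x).

Definition gram (R : realType) (U : normedModType R) (phi : U -> R) n
  (e : 'I_n -> U) u := \matrix_(i, j) hess phi u (e i) (e j).

(* The solution [w] of [h(y, w) = v(h(y, Z))] for all [y], where [h] is the
   Hessian metric: this is the connection dual to the flat one. *)
HB.lock Definition dual_operator (R : realType) (U : normedModType R)
    (phi : U -> R) n (e : 'I_n -> U) (v : U) (Z : U -> U) (u : U) : U :=
  \sum_i ((\row_j 'D_v (covector phi (e j) Z) u) *m invmx (gram phi e u)) ord0 i
    *: e i.

Section DualOperator.
Variables (R : realType) (U : normedModType R) (A V : set U).
Hypothesis AV : relatively_open A V.
Variables (n : nat) (e : 'I_n -> U) (k : 'I_n -> U -> R).
Hypothesis ek : frame V e k.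
Variable phi : U -> R.
Hypothesis phi_pot : potential_on A V phi.
Implicit Types (f : U -> R) (X Y Z F : U -> U).

Let phi_s : smooth_on A V phi. Proof. by case: phi_pot. Qed.
Let Dphi_s y : V y -> smooth_on A V ('D_y phi).
Proof. by move=> Vy; exact: smooth_on_derive. Qed.
Let V_lin (a : R) u v : V u -> V v -> V (a *: u + v).
Proof. by case: AV => _ + _; apply. Qed.

Lemma hessE u y z : hess phi u y z = 'D_y ('D_z phi) u.
Proof. by rewrite hess.unlock. Qed.

Lemma hess_sym u y z : A u -> V y -> V z -> hess phi u y z = hess phi u z y.
Proof. move=> Au Vy Vz; rewrite !hessE; exact: (derive_sym AV phi_s Au Vz Vy). Qed.

Lemma hess_linl (a : R) u y y' z : A u -> V y -> V y' -> V z ->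
  hess phi u (a *: y + y') z = a * hess phi u y z + hess phi u y' z.
Proof.
move=> Au Vy Vy' Vz; rewrite !hessE.
exact: (derive_lin AV a (Dphi_s Vz) Au Vy Vy').
Qed.

Lemma hess_linr (a : R) u y z z' : A u -> V y -> V z -> V z' ->
  hess phi u y (a *: z + z') = a * hess phi u y z + hess phi u y z'.
Proof.
move=> Au Vy Vz Vz'; rewrite (hess_sym Au Vy (V_lin a Vz Vz')) (hess_linl a Au Vz Vz' Vy).
by rewrite (hess_sym Au Vz Vy) (hess_sym Au Vz' Vy).
Qed.

Lemma hess0r u y : A u -> V y -> hess phi u y 0 = 0.
Proof.
move=> Au Vy; have V0 : V 0 by case: AV.
have := hess_linr (-1) Au Vy V0 V0.
by rewrite scaler0 addr0 mulN1r addNr.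
Qed.

Lemma hess_suml u z (a : 'I_n -> R) : A u -> V z ->
  hess phi u (\sum_i a i *: e i) z = \sum_i a i * hess phi u (e i) z.
Proof.
move=> Au Vz; rewrite hessE (derive_comb AV _ _ (Dphi_s Vz) Au (frame_mem ek)).
by apply: eq_bigr => i _; rewrite hessE.
Qed.

Lemma hess_inj u z z' : A u -> V z -> V z' ->
  (forall y, V y -> hess phi u y z = hess phi u y z') -> z = z'.
Proof.
move=> Au Vz Vz' zz'; apply/eqP; rewrite -subr_eq0; apply: contraT => d0.
have Vd : V (z - z') by exact: (dirs_sub AV).
have [_ /(_ u _ Au Vd d0)] := phi_pot; rewrite -[hessian _ _ _ _]hessE.
have dE : z - z' = -1 *: z' + z by rewrite scaleN1r addrC.
by rewrite {2}dE hess_linr// zz'// mulN1r addNr ltxx.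
Qed.

Local Notation covector := (covector phi).
Local Notation gram := (gram phi e).
Local Notation dual_operator := (dual_operator phi e).

Lemma covectorE y Z x : V y -> coord_field A V Z -> A x ->
  covector y Z x = 'D_(Z x) ('D_y phi) x.
Proof. by move=> Vy [_ ZV] Ax; rewrite /covector hess_sym ?hessE//; exact: ZV. Qed.

Lemma covector_smooth y Z : V y -> coord_field A V Z -> smooth_on A V (covector y Z).
Proof.
move=> Vy cZ; apply: (eq_on_smooth AV (f := fun x => 'D_(Z x) ('D_y phi) x)).
  by move=> x Ax; rewrite covectorE.
exact: (smooth_derive_along AV ek (Dphi_s Vy) cZ).
Qed.

(** A left null vector gives a combination [y] of the frame orthogonal to the whole frame. Positive
    definiteness makes [y] zero, and independence of the frame makes its coefficients zero. *)
Lemma gram_unit u : A u -> gram u \in unitmx.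
Proof.
move=> Au; rewrite unitmxE unitfE; apply/det0P => -[x x0 xG].
have Ve := frame_mem ek.
pose y := \sum_i x ord0 i *: e i.
have Vy : V y by exact: (frame_comb_mem AV ek).
have hy j : hess phi u y (e j) = 0.
  transitivity ((x *m gram u) ord0 j); last by rewrite xG mxE.
  rewrite /y hess_suml// [RHS]mxE.
  by apply: eq_bigr => i _; rewrite [gram u i j]mxE.
have y0 : y = 0.
  have V0 : V 0 by case: AV.
  apply: (hess_inj Au Vy V0) => z Vz; rewrite (hess0r Au Vz).
  have := hess_suml (k^~ z) Au Vy; rewrite -(frame_decomp ek Vz) => ->.
  by apply: big1 => i _; rewrite (hess_sym Au (Ve i) Vy) hy mulr0.
case/eqP: x0; apply/rowP => j; rewrite mxE.
rewrite -(frame_coord ek (fun i => x ord0 i) j) -/y y0.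
exact: (linear_map0 (frame_lin ek j)).
Qed.

Lemma dual_operator_mem v Z u : V (dual_operator v Z u).
Proof. rewrite dual_operator.unlock; exact: (frame_comb_mem AV ek). Qed.

(** For [y] in the frame this is the Gram system solved in the definition; both sides are linear in
    [y]. *)
Lemma dual_operatorP v Z u y : coord_field A V Z -> A u -> V v -> V y ->
  hess phi u y (dual_operator v Z u) = 'D_v (covector y Z) u.
Proof.
move=> cZ Au Vv Vy; have Ve := frame_mem ek; have [_ ZV] := cZ.
have frameP j : hess phi u (e j) (dual_operator v Z u) =
    'D_v (covector (e j) Z) u.
  rewrite (hess_sym Au (Ve j) (dual_operator_mem _ _ _)).
  rewrite dual_operator.unlock (hess_suml _ Au (Ve j)).
  set r := \row_j0 _; transitivity ((r *m invmx (gram u) *m gram u) ord0 j).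
    by rewrite [RHS]mxE; apply: eq_bigr => i _; rewrite [gram u i j]mxE.
  by rewrite mulmxKV ?gram_unit// mxE.
have cov_expand x : A x -> covector y Z x = \sum_j k j y * covector (e j) Z x.
  move=> Ax; rewrite /covector [in LHS](frame_decomp ek Vy) hess_suml//.
  by case: cZ => _; exact.
rewrite (eq_on_derive AV cov_expand Au Vv).
have := hess_suml (k^~ y) Au (dual_operator_mem v Z u).
rewrite -(frame_decomp ek Vy) => ->.
apply/esym/(@derive_val _ _ _ u); apply: is_derive_bigsum => j _.
rewrite frameP.
have cd := smooth_on_is_derive (covector_smooth (Ve j) cZ) Au Vv.
by apply: (is_derive_comp_linear (c := fun t => k j y * t) _ _ cd) => [a b c|t];
  [rewrite mulrDr mulrCA|apply: cvgMr; exact: cvg_id].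
Qed.

Lemma dual_operator_field X Z : coord_field A V X -> coord_field A V Z ->
  coord_field A V (fun u => dual_operator (X u) Z u).
Proof.
move=> cX cZ; have Ve := frame_mem ek.
rewrite dual_operator.unlock; apply: (coord_field_comb AV ek) => i.
apply: (eq_on_smooth AV (f := fun u =>
    \sum_j 'D_(X u) (covector (e j) Z) u * invmx (gram u) j i)).
  by move=> u _; rewrite mxE; apply: eq_bigr => j _; rewrite mxE.
apply: (smooth_on_sum AV) => j _; apply: (smooth_on_mul AV).
  exact: (smooth_derive_along AV ek (covector_smooth (Ve j) cZ) cX).
apply: (smooth_on_invmx AV gram_unit) => a b.
apply: (eq_on_smooth AV (f := 'D_(e a) ('D_(e b) phi))).
  by move=> u _; rewrite mxE hessE.
exact: (smooth_on_derive (Dphi_s (Ve b)) (Ve a)).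
Qed.

Lemma dual_operator_unique v Z u w : coord_field A V Z -> A u -> V v -> V w ->
  (forall y, V y -> hess phi u y w = 'D_v (covector y Z) u) ->
  dual_operator v Z u = w.
Proof.
move=> cZ Au Vv Vw wP; apply: (hess_inj Au (dual_operator_mem _ _ _) Vw).
by move=> y Vy; rewrite (dual_operatorP cZ Au Vv Vy) (wP y Vy).
Qed.

Lemma derive_covector X Z y u : coord_field A V X -> coord_field A V Z -> V y ->
  A u -> covector y (fun x => dual_operator (X x) Z x) u = 'D_(X u) (covector y Z) u.
Proof.
by move=> [_ VX] cZ Vy Au; exact: (dual_operatorP cZ Au (VX u Au) Vy).
Qed.

(** Expanding [Y] in the frame separates the derivatives of its coordinates, which give the flat
    term, from those of [covector (e i) Z], which give the dual term. *)
Lemma dual_operator_compat Y Z u v : coord_field A V Y -> coord_field A V Z ->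
  A u -> V v -> 'D_v (fun x => hess phi x (Y x) (Z x)) u =
    hess phi u ('D_v Y u) (Z u) + hess phi u (Y u) (dual_operator v Z u).
Proof.
move=> cY cZ Au Vv; have Ve := frame_mem ek.
have [_ VY] := cY; have [_ VZ] := cZ.
have E x : A x -> hess phi x (Y x) (Z x) = \sum_i k i (Y x) * covector (e i) Z x.
  move=> Ax; have := hess_suml (k^~ (Y x)) Ax (VZ x Ax).
  by rewrite -(frame_decomp ek (VY x Ax)).
rewrite (eq_on_derive AV E Au Vv).
rewrite (derive_field AV ek cY Au Vv) (hess_suml _ Au (VZ u Au)).
have := hess_suml (k^~ (Y u)) Au (dual_operator_mem v Z u).
rewrite -(frame_decomp ek (VY u Au)) => ->.
rewrite -big_split/=; apply: (@derive_val _ _ _ u); apply: is_derive_bigsum => i _.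
rewrite (dual_operatorP cZ Au Vv (Ve i)); apply: is_derive_mul.
  exact: (smooth_on_is_derive (coord_field_coord AV ek i cY) Au Vv).
exact: (smooth_on_is_derive (covector_smooth (Ve i) cZ) Au Vv).
Qed.

(** Identities are tested against every constant [y]. Torsion becomes [commutator] for ['D_y phi];
    curvature becomes [commutator] for [covector y Z], since [derive_covector] turns nested
    operators into iterated derivatives. *)
Lemma dual_flat_operator : flat_operator A V dual_operator.
Proof.
have Hsub u y z z' : A u -> V y -> V z -> V z' ->
    hess phi u y (z - z') = hess phi u y z - hess phi u y z'.
  by move=> Au Vy Vz Vz'; rewrite addrC -scaleN1r hess_linr// mulN1r addrC.
split.
- exact: dual_operator_field.
- move=> v Y Y' u cY cY' YY' Au Vv.
  apply: (dual_operator_unique cY Au Vv (dual_operator_mem _ _ _)) => y Vy.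
  rewrite (dual_operatorP cY' Au Vv Vy); apply: (eq_on_derive AV _ Au Vv) => x Ax.
  by rewrite /covector YY'.
- move=> a v v' Y u cY Au Vv Vv'.
  have Vd := dual_operator_mem.
  apply: (dual_operator_unique cY Au (V_lin a Vv Vv')) => [|y Vy]; first exact: V_lin.
  rewrite (hess_linr a Au Vy (Vd v Y u) (Vd v' Y u)).
  rewrite (dual_operatorP cY Au Vv Vy) (dual_operatorP cY Au Vv' Vy).
  by rewrite (derive_lin AV a (covector_smooth Vy cY) Au Vv Vv').
- move=> f v Y Y' u fs cY cY' Au Vv; have [_ VY] := cY; have [_ VY'] := cY'.
  have VYu := VY u Au; rewrite -addrA.
  have Vd := dual_operator_mem.
  have cF := coord_field_scale_add AV ek fs cY cY'.
  have Vw := V_lin (f u) (Vd v Y u) (Vd v Y' u).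
  apply: (dual_operator_unique cF Au Vv) => [|y Vy]; first exact: V_lin.
  rewrite (hess_linr _ Au Vy VYu Vw) (hess_linr _ Au Vy (Vd v Y u) (Vd v Y' u)).
  rewrite (dual_operatorP cY Au Vv Vy) (dual_operatorP cY' Au Vv Vy).
  have E x : A x -> covector y (fun x => f x *: Y x + Y' x) x =
      f x * covector y Y x + covector y Y' x.
    by move=> Ax; exact: (hess_linr (f x) Ax Vy (VY x Ax) (VY' x Ax)).
  rewrite (eq_on_derive AV E Au Vv); apply/esym/(@derive_val _ _ _ u).
  rewrite addrA; apply: is_deriveD; last first.
    exact: (smooth_on_is_derive (covector_smooth Vy cY') Au Vv).
  apply: is_derive_mul; first exact: (smooth_on_is_derive fs Au Vv).
  exact: (smooth_on_is_derive (covector_smooth Vy cY) Au Vv).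
- move=> X Y u cX cY Au; have [_ VX] := cX; have [_ VY] := cY.
  have VXu := VX u Au; have VYu := VY u Au.
  have VXY := derive_field_mem AV ek cY Au VXu.
  have VYX := derive_field_mem AV ek cX Au VYu.
  have Vd := dual_operator_mem.
  have Vb : V ('D_(X u) Y u - 'D_(Y u) X u) by exact: (dirs_sub AV).
  apply: (hess_inj Au _ Vb); first exact: (dirs_sub AV).
  move=> y Vy; rewrite (Hsub _ _ _ _ Au Vy (Vd _ _ _) (Vd _ _ _)).
  rewrite (dual_operatorP cY Au VXu Vy) (dual_operatorP cX Au VYu Vy).
  rewrite (hess_sym Au Vy Vb) hessE -(commutator AV ek (Dphi_s Vy) cX cY Au).
  congr (_ - _).
    by apply: (eq_on_derive AV _ Au VXu) => x Ax; exact: covectorE.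
  by apply: (eq_on_derive AV _ Au VYu) => x Ax; exact: covectorE.
move=> X Y Z u cX cY cZ Au; have [_ VX] := cX; have [_ VY] := cY.
have VXu := VX u Au; have VYu := VY u Au.
have VXY := derive_field_mem AV ek cY Au VXu.
have VYX := derive_field_mem AV ek cX Au VYu.
have Vd := dual_operator_mem.
have Vb : V ('D_(X u) Y u - 'D_(Y u) X u) by exact: (dirs_sub AV).
apply/esym/(dual_operator_unique cZ Au Vb); first exact: (dirs_sub AV).
move=> y Vy; rewrite (Hsub _ _ _ _ Au Vy (Vd _ _ _) (Vd _ _ _)).
rewrite (dual_operatorP (dual_operator_field cY cZ) Au VXu Vy).
rewrite (dual_operatorP (dual_operator_field cX cZ) Au VYu Vy).
rewrite -(commutator AV ek (covector_smooth Vy cZ) cX cY Au).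
congr (_ - _).
  by apply: (eq_on_derive AV _ Au VXu) => x Ax; exact: derive_covector.
by apply: (eq_on_derive AV _ Au VYu) => x Ax; exact: derive_covector.
Qed.

End DualOperator.

(** * Hessian structures on manifolds *)

Local Notation chart := Defs.coord.

Section ManifoldOperators.
Variables (R : realType) (T : pointedType) (U : normedModType R).
Variable m : chart_manifold T U.
Hypothesis m_wf : wf_manifold m.
Implicit Types (X Y Z : T -> U) (Op : U -> (U -> U) -> U -> U).

Lemma wf_relatively_open : relatively_open (coord_image m) (dirs m).
Proof.
by have [_ [V0 V_lin] _ A_open] := m_wf; split.
Qed.

Lemma in_coordE (Z : Type) (f : T -> Z) p : pts m p -> in_coord m f (chart m p) = f p.
Proof. by have [ci _ _ _] := m_wf; move=> mp; rewrite /in_coord/= pinvKV// inE. Qed.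

Lemma coord_imageP u : coord_image m u ->
  exists2 p, pts m p & [/\ chart m p = u & pinv (pts m) (chart m) u = p].
Proof.
have [ci _ _ _] := m_wf.
by move=> [p mp <-]; exists p => //; split=> //; rewrite pinvKV// inE.
Qed.

Lemma coord_image_coord p : pts m p -> coord_image m (chart m p).
Proof. by move=> mp; exists p. Qed.

Lemma vector_fieldP X : vector_field m X <->
  coord_field (coord_image m) (dirs m) (in_coord m X).
Proof.
split=> -[Xs XV]; split=> //.
  by move=> u /coord_imageP[p mp [_ pE]]; rewrite /in_coord/= pE; exact: XV.
by move=> p mp; rewrite -(in_coordE X mp); apply: XV; exact: coord_image_coord.
Qed.

(** [X] enters by its value at [p] only, whereas [Y] is differentiated and must be read in the
    chart. *)
Definition conn_of Op X Y p := Op (X p) (in_coord m Y) (chart m p).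

Lemma in_coord_conn_of Op X Y u : coord_image m u ->
  in_coord m (conn_of Op X Y) u = Op (in_coord m X u) (in_coord m Y) u.
Proof.
by move=> /coord_imageP[p mp [pu pE]]; rewrite /in_coord/= pE /conn_of pu.
Qed.

Lemma in_coord_agree (Z : Type) (f g : T -> Z) : agree m f g ->
  forall u, coord_image m u -> in_coord m f u = in_coord m g u.
Proof. by move=> fg u /coord_imageP[p mp [_ pE]]; rewrite /in_coord/= pE fg. Qed.

Lemma flat_operator_connection Op n (e : 'I_n -> U) (k : 'I_n -> U -> R) :
  frame (dirs m) e k -> flat_operator (coord_image m) (dirs m) Op ->
  [/\ affine_connection m (conn_of Op), torsion_free m (conn_of Op)
    & curvature_free m (conn_of Op)].
Proof.
move=> ek [Ofield Oeq Olin Oleib Otors Oflat].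
have AV := wf_relatively_open.
have connP X Y : vector_field m X -> vector_field m Y -> vector_field m (conn_of Op X Y).
  move=> /vector_fieldP cX /vector_fieldP cY; apply/vector_fieldP.
  apply: (eq_on_coord_field AV) (Ofield _ _ cX cY) => u Au.
  by rewrite in_coord_conn_of.
have fieldV X p : vector_field m X -> pts m p -> dirs m (X p) by move=> [_]; exact.
split.
- split=> //.
  + move=> X X' Y Y' fX _ /vector_fieldP cY /vector_fieldP cY' XX' YY' p mp.
    rewrite /conn_of XX'//; apply: Oeq => //; first exact: in_coord_agree.
      exact: coord_image_coord.
    by rewrite -XX'//; exact: fieldV.
  + move=> f X X' Y fs fX fX' /vector_fieldP cY p mp.
    apply: Olin => //; [exact: coord_image_coord|exact: fieldV|exact: fieldV].
  move=> f X Y Y' fs fX fY /vector_fieldP cY' p mp.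
  rewrite /conn_of /deriv_along -[in RHS](in_coordE f mp) -[Y p in RHS](in_coordE Y mp).
  apply: (Oleib (in_coord m f)) => //; first exact/vector_fieldP.
    exact: coord_image_coord.
  exact: fieldV.
- move=> X Y /vector_fieldP cX /vector_fieldP cY p mp.
  rewrite /conn_of /lie_bracket /deriv_along.
  rewrite -[X p in LHS](in_coordE X mp) -[Y p in LHS](in_coordE Y mp).
  rewrite -[X p in RHS](in_coordE X mp) -[Y p in RHS](in_coordE Y mp).
  by apply: Otors => //; exact: coord_image_coord.
move=> X Y Z fX fY fZ p mp.
have Ap := coord_image_coord mp.
have cX := (vector_fieldP X).1 fX; have cY := (vector_fieldP Y).1 fY.
have cZ := (vector_fieldP Z).1 fZ.
(* The chart reading of the inner connection agrees with [Op] only on the image of the chart, so it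
   is replaced under the outer [Op] by locality. *)
have E W W' : vector_field m W -> vector_field m W' ->
    conn_of Op W (conn_of Op W' Z) p = Op (W p)
      (fun x => Op (in_coord m W' x) (in_coord m Z) x) (chart m p).
  move=> fW fW'; apply: Oeq => //.
  - by apply/vector_fieldP; exact: connP.
  - by apply: Ofield => //; exact/vector_fieldP.
  - by move=> x Ax; exact: in_coord_conn_of.
  - exact: fieldV.
rewrite !E// /conn_of /lie_bracket /deriv_along.
rewrite -(in_coordE X mp) -(in_coordE Y mp).
exact: Oflat.
Qed.

Lemma smooth_in_coord_eq (Z : normedModType R) (f : U -> Z) (g : T -> Z) :
  smooth_on (coord_image m) (dirs m) f ->
  (forall u, coord_image m u -> f u = in_coord m g u) -> smooth m g.
Proof. by move=> fs fg; apply: (eq_on_smooth wf_relatively_open) fs. Qed.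

Variables (n : nat) (e : 'I_n -> U) (k : 'I_n -> U -> R) (phi : U -> R).

Definition hessian_structure : dual_structure T U :=
  DualStructure (fun p => hessian phi (chart m p))
    (conn_of (fun v F u => 'D_v F u)) (conn_of (dual_operator phi e)).

Hypothesis ek : frame (dirs m) e k.
Hypothesis phi_pot : potential_on (coord_image m) (dirs m) phi.

Let AV := wf_relatively_open.

Lemma hessian_riemannian : riemannian_metric m (metric hessian_structure).
Proof.
have Ap p := @coord_image_coord p.
split=> /=.
- move=> p a u v z mp Vu Vv Vz; rewrite !hessian_hess.
  exact: (hess_linl AV phi_pot a (Ap p mp) Vu Vv Vz).
- move=> p u v mp Vu Vv; rewrite !hessian_hess.
  exact: (hess_sym AV phi_pot (Ap p mp) Vu Vv).
- by move=> p u mp Vu u0; have [_] := phi_pot; apply=> //; exact: Ap.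
move=> X Y /vector_fieldP cX /vector_fieldP cY.
apply: (@smooth_in_coord_eq _ (fun u => \sum_i (k i \o in_coord m X) u *
    covector phi (e i) (in_coord m Y) u)).
  apply: (smooth_on_sum AV) => i _; apply: (smooth_on_mul AV).
    exact: (coord_field_coord AV ek).
  exact: (covector_smooth AV ek phi_pot (frame_mem ek i) cY).
move=> u Au; have [_ XV] := cX; have [_ YV] := cY.
have [p mp [pu pE]] := coord_imageP Au.
rewrite -[in RHS]pu [RHS](in_coordE _ mp) hessian_hess.
rewrite -(in_coordE X mp) -(in_coordE Y mp) pu.
have := hess_suml AV ek phi_pot (k^~ (in_coord m X u)) Au (YV u Au).
by rewrite -(frame_decomp ek (XV u Au)) => ->.
Qed.

Lemma hessian_structure_dual : dual_connections m (metric hessian_structure)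
  (conn hessian_structure) (dual_conn hessian_structure).
Proof.
move=> X Y Z /= fX /vector_fieldP cY /vector_fieldP cZ p mp.
have Ap := coord_image_coord mp.
have VX : dirs m (X p) by case: fX => _; exact.
rewrite /deriv_along.
rewrite (eq_on_derive AV (g := fun x => hess phi x (in_coord m Y x) (in_coord m Z x)) _ Ap VX).
  rewrite (dual_operator_compat AV ek phi_pot cY cZ Ap VX) /conn_of.
  by rewrite !hessian_hess (in_coordE Y mp) (in_coordE Z mp).
move=> x /coord_imageP[q mq [qx qE]].
by rewrite -hessian_hess /in_coord/= qE qx.
Qed.

Lemma hessian_structureP : induced_by_potential m phi hessian_structure /\
  dually_flat m hessian_structure.
Proof.
have D := flat_operator_connection ek (derive_flat_operator AV ek).
have D' := flat_operator_connection ek (dual_flat_operator AV ek phi_pot).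
have [D'1 _ _] := D'; split.
  split; [exact: phi_pot| | |exact: D'1|exact: hessian_structure_dual].
    by move=> p u v _ _ _; reflexivity.
  by move=> X Y _ _ p _; reflexivity.
split; [exact: m_wf|exact: hessian_riemannian|exact: D|exact: D'|].
exact: hessian_structure_dual.
Qed.

End ManifoldOperators.

Lemma potential_on_sub (R : realType) (U : normedModType R) (A A' V V' : set U)
    (phi : U -> R) : A' `<=` A -> V' `<=` V ->
  potential_on A V phi -> potential_on A' V' phi.
Proof.
move=> AA VV [phis phi0]; split=> [vs vsV|u v Au Vv]; last first.
  by apply: phi0; [exact: AA|exact: VV].
have [c d] := phis vs (fun v vvs => VV _ (vsV v vvs)).
split; first exact: continuous_subspaceW AA c.
by move=> u v Au Vv; apply: d; [exact: AA|exact: VV].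
Qed.

Section Restriction.
Variables (R : realType) (T : pointedType) (U : normedModType R).
Variables m m' : chart_manifold T U.
Hypotheses (m_wf : wf_manifold m) (m'_wf : wf_manifold m').
Hypothesis m'm : submanifold m' m.
Variables (n : nat) (e : 'I_n -> U) (k : 'I_n -> U -> R).
Variables (n' : nat) (e' : 'I_n' -> U) (k' : 'I_n' -> U -> R).
Hypotheses (ek : frame (dirs m) e k) (ek' : frame (dirs m') e' k').
Variable phi : U -> R.
Hypothesis phi_pot : potential_on (coord_image m) (dirs m) phi.

Lemma coord_image_sub : coord_image m' `<=` coord_image m.
Proof.
have [pp _ cc] := m'm.
by move=> _ [p mp <-]; exists p; [exact: pp|rewrite cc].
Qed.

Lemma potential_on_submanifold : potential_on (coord_image m') (dirs m') phi.
Proof. by have [_ VV _] := m'm; exact: potential_on_sub coord_image_sub VV phi_pot. Qed.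

Lemma in_coord_sub (Z : Type) (f f' : T -> Z) : agree m' f' f ->
  forall u, coord_image m' u -> in_coord m' f' u = in_coord m f u.
Proof.
have [pp _ cc] := m'm.
move=> ff u /(coord_imageP m'_wf)[p mp [pu pE]].
have fE := in_coordE m_wf f (pp _ mp).
by rewrite -cc// pu in fE; rewrite [LHS]/in_coord/= pE ff.
Qed.

(* In the directions of [m'], the equation defining the dual connection of [m]
   only involves the values of the fields on [m'], so its projection satisfies
   the equation defining the dual connection of [m']. *)
Lemma hessian_restriction :
  restriction m m' (hessian_structure m e phi) (hessian_structure m' e' phi).
Proof.
have [pp VV cc] := m'm.
have AV := wf_relatively_open m_wf; have AV' := wf_relatively_open m'_wf.
have phi_pot' := potential_on_submanifold.
have [[D _ _] [D' _ _]] :=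
  (flat_operator_connection m'_wf ek' (derive_flat_operator AV' ek'),
   flat_operator_connection m'_wf ek' (dual_flat_operator AV' ek' phi_pot')).
have V'0 : dirs m' 0 by case: AV'.
split; [exact: m'm| |split; first exact: D|split; first exact: D'].
- by move=> p u v mp _ _; rewrite /= (cc _ mp).
- move=> X' Y' X Y fX' fY' fX fY XX YY p mp.
  have [_ /(_ p mp) VX'] := fX'.
  have [D1 _ _ _] := D; have [_ /(_ p mp) VD] := D1 _ _ fX' fY'.
  split; [exact: VD|move=> z Vz /=].
  (* A derivative in a direction of [m'] sees only values on [m'], so the flat connection of [m] is
     already tangent and the projection changes nothing. *)
  have -> : conn_of m (fun v F u => 'D_v F u) X Y p =
      conn_of m' (fun v F u => 'D_v F u) X' Y' p.
    rewrite /conn_of -XX// -cc//; apply/esym.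
    apply: (eq_on_derive AV') => //; last exact: coord_image_coord.
    exact: in_coord_sub.
  rewrite subrr hessian_hess (hess_sym AV phi_pot).
  + by apply: (hess0r AV phi_pot); [apply/coord_image_coord/pp|exact: VV].
  + by apply/coord_image_coord/pp.
  + by apply: VV.
  + by apply: VV.
move=> X' Y' X Y fX' fY' fX fY XX YY p mp.
have [_ /(_ p mp) VX'] := fX'.
have [D1 _ _ _] := D'; have [_ /(_ p mp) VD] := D1 _ _ fX' fY'.
split; [exact: VD|move=> z Vz /=].
have mp' := pp _ mp; have Ap := coord_image_coord mp'.
have Ap' := coord_image_coord mp.
have cY := (vector_fieldP m_wf Y).1 fY; have cY' := (vector_fieldP m'_wf Y').1 fY'.
have VX : dirs m (X p) by case: fX => _; exact.
have Vd := dual_operator_mem AV ek phi.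
have Vd1 : dirs m (conn_of m (dual_operator phi e) X Y p) by exact: Vd.
have Vd2 : dirs m (conn_of m' (dual_operator phi e') X' Y' p) by exact: VV.
have Vsub := dirs_sub AV Vd1 Vd2.
rewrite hessian_hess (hess_sym AV phi_pot Ap Vsub (VV _ Vz)).
rewrite addrC -scaleN1r (hess_linr AV phi_pot _ Ap (VV _ Vz) Vd2 Vd1).
rewrite {2}/conn_of (dual_operatorP AV ek phi_pot cY Ap VX (VV _ Vz)).
rewrite -[in X in X + _]cc// /conn_of.
rewrite (dual_operatorP AV' ek' phi_pot' cY' Ap' VX' Vz).
rewrite mulN1r addrC -XX// -cc//; apply/eqP; rewrite subr_eq0; apply/eqP.
apply: (eq_on_derive AV' _ Ap' VX') => x Ax.
by rewrite /covector (in_coord_sub YY).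
Qed.

End Restriction.

(** * The chart of the Markov manifolds *)

Section MarkovCoordinates.
Variables (R : realType) (d : nat) (E : {set 'I_d.+1 * 'I_d.+1}).
Hypothesis Econ : strongly_connected E.
Local Notation mx := 'M[R]_d.+1.
Implicit Types (f eta v : mx).

Lemma sum_edges_out (g : 'I_d.+1 -> 'I_d.+1 -> R) :
  \sum_(z in E) g z.1 z.2 = \sum_x \sum_(y | (x, y) \in E) g x y.
Proof.
rewrite pair_big_dep/=; apply: eq_bigl => -[x y] //=.
Qed.

Lemma sum_edges_in (g : 'I_d.+1 -> 'I_d.+1 -> R) :
  \sum_(z in E) g z.1 z.2 = \sum_y \sum_(x | (x, y) \in E) g x y.
Proof. by rewrite sum_edges_out (exchange_big_dep xpredT). Qed.

Lemma sum_in_sum eta : \sum_x in_sum E eta x = \sum_(z in E) eta z.1 z.2.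
Proof. by rewrite (sum_edges_in eta). Qed.

Lemma sum_col_edge (a : 'I_d.+1 -> R) f y : edge_fun E f ->
  \sum_x a x * f x y = \sum_(x | (x, y) \in E) a x * f x y.
Proof.
move=> f0; rewrite [RHS]big_mkcond; apply: eq_bigr => x _.
by case: ifPn => // /f0 ->; rewrite mulr0.
Qed.

Lemma in_sum_gt0 eta x : pos_fun E eta -> 0 < in_sum E eta x.
Proof.
move=> etap; have [y yx] := in_edge Econ x.
rewrite /in_sum (bigD1 y)//= ltr_wpDr//; last exact: etap.2.
by rewrite sumr_ge0// => z _; exact: pos_fun_ge0 etap _ _.
Qed.

Lemma WtildeP f : Wtilde E f -> [/\ pos_fun E f, forall i, 0 < mu f ord0 i,
  \sum_i mu f ord0 i = 1 & mu f *m f = mu f].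
Proof.
by move=> [fp f1]; have [_ mu0 mu1 muf] := muP Econ fp;
  split=> //; rewrite muf f1 scale1r.
Qed.

(** With root 1, [mu f] is fixed by [f], so it can be read off as the incoming marginal of
    [Tbar f]. *)
Lemma in_sum_Tbar f y : Wtilde E f -> in_sum E (Tbar f) y = mu f ord0 y.
Proof.
move=> /WtildeP[[f0 _] _ _ muf]; rewrite -[in RHS]muf mxE (sum_col_edge _ _ f0).
by apply: eq_bigr => x _; rewrite mxE.
Qed.

Lemma Tbar_Mtilde f : Wtilde E f -> Mtilde E (Tbar f).
Proof.
move=> Wf; have [[f0 fp] mu0 mu1 _] := WtildeP Wf; split.
  by split=> x y xy; rewrite mxE; [rewrite f0// mulr0|rewrite mulr_gt0// fp].
rewrite -sum_in_sum -[RHS]mu1; apply: eq_bigr => x _; exact: in_sum_Tbar.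
Qed.

Definition Tbar_inv eta : mx := \matrix_(x, y) (eta x y / in_sum E eta x).

Lemma TbarK f : Wtilde E f -> Tbar_inv (Tbar f) = f.
Proof.
move=> Wf; have [_ mu0 _ _] := WtildeP Wf.
apply/matrixP => x y; rewrite mxE in_sum_Tbar// mxE mulrC mulKf// gt_eqF//.
Qed.

Lemma Tbar_inv_eigen eta : Mtilde E eta ->
  [/\ pos_fun E (Tbar_inv eta), forall x, 0 < (\row_x in_sum E eta x) ord0 x,
      \sum_x (\row_x in_sum E eta x) ord0 x = 1 &
      (\row_x in_sum E eta x) *m Tbar_inv eta = \row_x in_sum E eta x].
Proof.
move=> [etap eta1]; have in0 x := in_sum_gt0 x etap; have [eta0 etap'] := etap.
split.
- split=> x y xy; rewrite mxE; first by rewrite eta0// mul0r.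
  by rewrite divr_gt0// etap'.
- by move=> x; rewrite mxE.
- by under eq_bigr do rewrite mxE; rewrite sum_in_sum.
apply/rowP => y; rewrite mxE; transitivity (\sum_x eta x y).
  by apply: eq_bigr => x _; rewrite !mxE mulrCA divff ?mulr1// gt_eqF.
by rewrite [RHS]mxE /in_sum [RHS]big_mkcond; apply: eq_bigr => x _; case: ifPn => // /eta0.
Qed.

Lemma Tbar_inv_perron eta : Mtilde E eta ->
  Wtilde E (Tbar_inv eta) /\ mu (Tbar_inv eta) = \row_x in_sum E eta x.
Proof.
move=> /Tbar_inv_eigen[fp v0 v1 vf].
have vf1 : (\row_x in_sum E eta x) *m Tbar_inv eta = 1 *: \row_x in_sum E eta x.
  by rewrite scale1r.
by have [] := perron_eigen Econ fp ltr01 v0 v1 vf1.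
Qed.

Lemma Tbar_invK eta : Mtilde E eta -> Tbar (Tbar_inv eta) = eta.
Proof.
move=> Meta; have [_ muE] := Tbar_inv_perron Meta; have [etap _] := Meta.
apply/matrixP => x y; rewrite mxE muE !mxE mulrCA divff ?mulr1// gt_eqF//.
exact: in_sum_gt0.
Qed.

Lemma Tbar_bij : set_bij (Wtilde E) (Mtilde E) (@Tbar R d).
Proof.
split=> [f Wf|f g /set_mem Wf /set_mem Wg fg|eta Meta]; first exact: Tbar_Mtilde.
  by rewrite -(TbarK Wf) -(TbarK Wg) fg.
exists (Tbar_inv eta); last exact: Tbar_invK.
by have [] := Tbar_inv_perron Meta.
Qed.

(** The coordinates of [mu w *m w] sum to the root by the eigenvector equation, and to the mass 1 of
    [mu w] because the rows of [w] sum to 1. *)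
Lemma Wset_Wtilde : @Wset R d E `<=` Wtilde E.
Proof.
move=> w [wp w1]; split=> //; have [r0 mu0 mu1 muw] := muP Econ wp.
have [w0 _] := wp.
have := congr1 (fun v : 'rV[R]_d.+1 => \sum_y v ord0 y) muw.
under [in RHS]eq_bigr do rewrite mxE; rewrite -mulr_sumr mu1 mulr1 => <-.
under eq_bigr do rewrite mxE (sum_col_edge _ _ w0).
rewrite -(sum_edges_in (fun x y => mu w ord0 x * w x y)).
rewrite (sum_edges_out (fun x y => mu w ord0 x * w x y)) -[RHS]mu1.
by apply: eq_bigr => x _; rewrite -mulr_sumr w1 mulr1.
Qed.

Lemma out_sum_Tbar (w : mx) x : Wset E w -> out_sum E (Tbar w) x = mu w ord0 x.
Proof.
move=> [_ w1]; rewrite /out_sum; under eq_bigr do rewrite mxE.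
by rewrite -mulr_sumr w1 mulr1.
Qed.

(** Row [x] of [Tbar_inv eta] sums to outgoing over incoming mass at [x], so unit row sums
    correspond to the balance equations of [Mset]. *)
Lemma Tbar_Wset_bij : set_bij (Wset E) (Mset E) (@Tbar R d).
Proof.
split=> [w Ww|f g /set_mem Wf /set_mem Wg fg|eta [Meta io]].
- have Wtw := Wset_Wtilde Ww; split; first exact: Tbar_Mtilde.
  by move=> x; rewrite out_sum_Tbar// in_sum_Tbar.
- by rewrite -(TbarK (Wset_Wtilde Wf)) -(TbarK (Wset_Wtilde Wg)) fg.
exists (Tbar_inv eta); last exact: Tbar_invK.
have [[fp _] _] := Tbar_inv_perron Meta; split=> // x; have [etap _] := Meta.
under eq_bigr do rewrite mxE.
by rewrite -mulr_suml -/(out_sum E eta x) io divff// gt_eqF// in_sum_gt0.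
Qed.

Lemma coord_image_Wtilde : coord_image (Wtilde_manifold R E) = Mtilde E.
Proof.
have [f_fun _ f_surj] := Tbar_bij.
by apply/seteqP; split=> [_ [f Wf <-]|eta /f_surj]; [exact: f_fun|].
Qed.

Lemma coord_image_W : coord_image (W_manifold R E) = Mset E.
Proof.
have [f_fun _ f_surj] := Tbar_Wset_bij.
by apply/seteqP; split=> [_ [f Wf <-]|eta /f_surj]; [exact: f_fun|].
Qed.

Lemma out_sum_lin x : linear_map (fun v : mx => out_sum E v x).
Proof.
move=> a u v; rewrite /out_sum scaler_sumr -big_split/=.
by apply: eq_bigr => y _; rewrite !mxE.
Qed.

Lemma in_sum_lin x : linear_map (fun v : mx => in_sum E v x).
Proof.
move=> a u v; rewrite /in_sum scaler_sumr -big_split/=.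
by apply: eq_bigr => y _; rewrite !mxE.
Qed.

Lemma total_lin : linear_map (fun v : mx => \sum_(z in E) v z.1 z.2).
Proof.
move=> a u v; rewrite scaler_sumr -big_split/=.
by apply: eq_bigr => y _; rewrite !mxE.
Qed.

Lemma entry_lin x y : linear_map (fun v : mx => v x y).
Proof. by move=> a u v; rewrite !mxE. Qed.

Lemma edge_fun_lin (a : R) u v : edge_fun E u -> edge_fun E v -> edge_fun E (a *: u + v).
Proof. by move=> u0 v0 x y xy; rewrite !mxE u0// v0// mulr0 addr0. Qed.

Lemma edge_fun0 : edge_fun E (0 : mx).
Proof. by move=> x y _; rewrite mxE. Qed.

Lemma Mtilde_dirs_lin (a : R) u v : Mtilde_dirs E u -> Mtilde_dirs E v ->
  Mtilde_dirs E (a *: u + v).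
Proof.
move=> [u0 us] [v0 vs]; split; first exact: edge_fun_lin.
by rewrite total_lin us vs scaler0 addr0.
Qed.

Lemma Mset_dirs_lin (a : R) u v : Mset_dirs E u -> Mset_dirs E v ->
  Mset_dirs E (a *: u + v).
Proof.
move=> [u0 us] [v0 vs]; split; first exact: Mtilde_dirs_lin.
by move=> x; rewrite (out_sum_lin x) (in_sum_lin x) us vs.
Qed.

Lemma Mtilde_dirs0 : Mtilde_dirs E (0 : mx).
Proof. by split; [exact: edge_fun0|rewrite (linear_map0 total_lin)]. Qed.

Lemma Mset_dirs0 : Mset_dirs E (0 : mx).
Proof.
split=> [|x]; first exact: Mtilde_dirs0.
by rewrite (linear_map0 (out_sum_lin x)) (linear_map0 (in_sum_lin x)).
Qed.

Lemma Mtilde_sub u v : Mtilde E u -> Mtilde E v -> Mtilde_dirs E (u - v).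
Proof.
move=> [[u0 _] us] [[v0 _] vs].
have -> : u - v = -1 *: v + u by rewrite scaleN1r addrC.
by split; [exact: edge_fun_lin|rewrite total_lin us vs scaleN1r addNr].
Qed.

Lemma Mset_sub u v : Mset E u -> Mset E v -> Mset_dirs E (u - v).
Proof.
move=> [Mu uio] [Mv vio]; split=> [|x]; first exact: Mtilde_sub.
by rewrite (linear_mapB (out_sum_lin x)) (linear_mapB (in_sum_lin x)) uio vio.
Qed.

Lemma Mtilde_open u : Mtilde E u ->
  \forall v \near (0 : mx), Mtilde_dirs E v -> Mtilde E (u + v).
Proof.
move=> [[u0 up] us].
have uv : \forall v \near (0 : mx), forall z, z \in E -> 0 < (u + v) z.1 z.2.
  apply: (@filter_forall _ _ (fun z (v : mx) => z \in E -> 0 < (u + v) z.1 z.2)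
    (nbhs (0 : mx))) => z.
  have [zE|zE] := boolP (z \in E); last exact: nearW.
  have uz : 0 < u z.1 z.2 by apply: up; rewrite -surjective_pairing.
  have /(_ 0) := @coord_continuous R d.+1 d.+1 z.1 z.2.
  rewrite /continuous_at mxE => /cvgr0Pnorm_lt/(_ _ uz).
  apply: filterS => v vz _; rewrite mxE addrC -(opprK (u _ _)) subr_gt0.
  by move: vz; rewrite ltr_norml => /andP[].
apply: filterS uv => v vp [v0 vs]; split; last first.
  by rewrite -[u]scale1r total_lin us vs scale1r addr0.
by split=> [x y xy|x y xy]; [rewrite mxE u0// v0// addr0|exact: (vp (x, y))].
Qed.

Lemma Mset_open u : Mset E u ->
  \forall v \near (0 : mx), Mset_dirs E v -> Mset E (u + v).
Proof.
move=> [Mu uio]; apply: filterS (Mtilde_open Mu) => v Mv [/Mv Muv vio].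
split=> // x.
by rewrite (linear_mapD (out_sum_lin x)) (linear_mapD (in_sum_lin x)) uio vio.
Qed.

Lemma Wtilde_manifold_wf : wf_manifold (Wtilde_manifold R E).
Proof.
have [_ inj _] := Tbar_bij; split; rewrite ?coord_image_Wtilde //=.
- by split; [exact: Mtilde_dirs0|exact: Mtilde_dirs_lin].
- exact: Mtilde_sub.
- exact: Mtilde_open.
Qed.

Lemma W_manifold_wf : wf_manifold (W_manifold R E).
Proof.
have [_ inj _] := Tbar_Wset_bij; split; rewrite ?coord_image_W //=.
- by split; [exact: Mset_dirs0|exact: Mset_dirs_lin].
- exact: Mset_sub.
- exact: Mset_open.
Qed.

Lemma W_submanifold : submanifold (W_manifold R E) (Wtilde_manifold R E).
Proof. by split=> //=; [exact: Wset_Wtilde|move=> v []]. Qed.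

End MarkovCoordinates.

(** * The potential *)

Section PotentialPhibar.
Variables (R : realType) (d : nat) (E : {set 'I_d.+1 * 'I_d.+1}).
Hypothesis Econ : strongly_connected E.
Local Notation mx := 'M[R]_d.+1.
Implicit Types (eta u v : mx).

Let AV := wf_relatively_open (Wtilde_manifold_wf R Econ).

Let Mtilde_AV : relatively_open (@Mtilde R d E) (Mtilde_dirs E).
Proof. by rewrite -(coord_image_Wtilde R Econ); exact: AV. Qed.

Lemma Mtilde_edge eta x y : Mtilde E eta -> (x, y) \in E -> 0 < eta x y.
Proof. by move=> [[_ ep] _]; exact: ep. Qed.

Lemma Mtilde_in_sum eta x : Mtilde E eta -> 0 < in_sum E eta x.
Proof. by move=> [ep _]; exact: in_sum_gt0. Qed.

Lemma is_derive_linear_map (c : mx -> R) eta v : linear_map c -> is_derive eta v c (c v).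
Proof.
move=> c_lin; apply: (is_derive_comp_linear c_lin (f := id)).
exact: linear_mx_continuous.
Qed.

Lemma smooth_linear_map (c : mx -> R) : linear_map c ->
  smooth_on (Mtilde E) (Mtilde_dirs E) c.
Proof.
by move=> c_lin; apply: (smooth_on_linear Mtilde_AV c_lin); exact: linear_mx_continuous.
Qed.

Lemma phibar_smooth : smooth_on (Mtilde E) (Mtilde_dirs E) (@phibar R d E).
Proof.
have AVt := Mtilde_AV.
apply: (smooth_on_sub AVt).
  apply: (smooth_on_sum AVt) => z zE; apply: (smooth_on_mul AVt).
    by apply: smooth_linear_map; exact: entry_lin.
  apply: (smooth_on_ln AVt); first by apply: smooth_linear_map; exact: entry_lin.
  by move=> eta Meta; apply: Mtilde_edge => //; rewrite -surjective_pairing.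
apply: (smooth_on_sum AVt) => x _; apply: (smooth_on_mul AVt).
  by apply: smooth_linear_map; exact: out_sum_lin.
apply: (smooth_on_ln AVt); first by apply: smooth_linear_map; exact: in_sum_lin.
by move=> eta; exact: Mtilde_in_sum.
Qed.

Definition dphibar v eta : R :=
  \sum_(z in E) v z.1 z.2 * (ln (eta z.1 z.2) + 1) -
  \sum_x (out_sum E v x * ln (in_sum E eta x) +
    out_sum E eta x * (in_sum E v x / in_sum E eta x)).

Lemma derive_phibar eta v : Mtilde E eta -> 'D_v (@phibar R d E) eta = dphibar v eta.
Proof.
move=> Meta; apply: (@derive_val _ _ _ eta); apply: is_deriveB.
  apply: is_derive_bigsum => z zE.
  have ez : 0 < eta z.1 z.2 by apply: Mtilde_edge => //; rewrite -surjective_pairing.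
  have zD := is_derive_linear_map eta v (@entry_lin R d z.1 z.2).
  apply: is_derive_eq (is_derive_mul zD (is_derive_ln ez zD)) _.
  by rewrite [eta _ _ * _]mulrC divfK ?gt_eqF// mulrDr mulr1.
apply: is_derive_bigsum => x _; have ix := Mtilde_in_sum x Meta.
have oD := is_derive_linear_map eta v (out_sum_lin E x).
have iD := is_derive_linear_map eta v (in_sum_lin E x).
exact: is_derive_mul oD (is_derive_ln ix iD).
Qed.

Lemma hessian_phibar eta u v : Mtilde E eta -> Mtilde_dirs E u -> Mtilde_dirs E v ->
  hessian (@phibar R d E) eta u v = \sum_(z in E) eta z.1 z.2 *
    (u z.1 z.2 / eta z.1 z.2 - in_sum E u z.1 / in_sum E eta z.1) *
    (v z.1 z.2 / eta z.1 z.2 - in_sum E v z.1 / in_sum E eta z.1).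
Proof.
move=> Meta Vu Vv.
rewrite /hessian (eq_on_derive Mtilde_AV (g := dphibar v) _ Meta Vu); last first.
  by move=> x Mx; exact: derive_phibar.
have ez z : z \in E -> 0 < eta z.1 z.2.
  by move=> zE; apply: Mtilde_edge => //; rewrite -surjective_pairing.
have ix x := Mtilde_in_sum x Meta.
transitivity (\sum_(z in E) v z.1 z.2 * (u z.1 z.2 / eta z.1 z.2) -
  \sum_x (out_sum E v x * (in_sum E u x / in_sum E eta x) +
    (out_sum E u x * (in_sum E v x / in_sum E eta x) +
     out_sum E eta x * (in_sum E v x *
      (- in_sum E u x * (in_sum E eta x)^-1 * (in_sum E eta x)^-1))))).
  have scaleD (c : R) (f : mx -> R) l : is_derive eta u f l ->
      is_derive eta u (fun x => c * f x) (c * l).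
    move=> fl; apply: (is_derive_comp_linear (c := fun t => c * t) _ _ fl) => [a s t|t].
      by rewrite mulrDr mulrCA.
    by apply: cvgMr; exact: cvg_id.
  apply: (@derive_val _ _ _ eta); apply: is_deriveB.
    apply: is_derive_bigsum => z zE; apply: scaleD.
    have zD := is_derive_linear_map eta u (@entry_lin R d z.1 z.2).
    rewrite -[X in is_derive _ _ _ X]addr0; apply: is_deriveD.
    exact: is_derive_ln (ez z zE) zD.
  apply: is_derive_bigsum => x _.
  have oD := is_derive_linear_map eta u (out_sum_lin E x).
  have iD := is_derive_linear_map eta u (in_sum_lin E x).
  apply: is_deriveD; first by apply: scaleD; exact: is_derive_ln (ix x) iD.
  apply: is_derive_mul => //; apply: scaleD.
  by apply: is_derive_inv iD; rewrite gt_eqF.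
pose I x := in_sum E u x / in_sum E eta x; pose J x := in_sum E v x / in_sum E eta x.
(* The vertex sum is redistributed over outgoing edges, after which both sides agree edge by
   edge. *)
transitivity (\sum_(z in E) (v z.1 z.2 * (u z.1 z.2 / eta z.1 z.2) -
    (v z.1 z.2 * I z.1 + u z.1 z.2 * J z.1 - eta z.1 z.2 * (I z.1 * J z.1)))).
  rewrite [RHS]sumrB; congr (_ - _).
  rewrite (sum_edges_out E (fun x y => v x y * I x + u x y * J x - eta x y * (I x * J x))).
  apply: eq_bigr => x _; rewrite sumrB big_split/= -!mulr_suml.
  rewrite -/(out_sum E v x) -/(out_sum E u x) -/(out_sum E eta x) /I /J; ring.
apply: eq_bigr => z zE; rewrite -/(I z.1) -/(J z.1).
have := ez z zE; move: (I z.1) (J z.1) (eta z.1 z.2) => i j t t0.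
by field; rewrite gt_eqF.
Qed.

Lemma hessian_phibar_gt0 eta v : Mtilde E eta -> Mtilde_dirs E v -> v != 0 ->
  0 < hessian (@phibar R d E) eta v v.
Proof.
move=> Meta Vv vn0; rewrite hessian_phibar// lt_def.
have ez z : z \in E -> 0 < eta z.1 z.2.
  by move=> zE; apply: Mtilde_edge => //; rewrite -surjective_pairing.
have ix x := Mtilde_in_sum x Meta.
set q := fun z : 'I_d.+1 * 'I_d.+1 =>
  v z.1 z.2 / eta z.1 z.2 - in_sum E v z.1 / in_sum E eta z.1.
have q0 z : z \in E -> 0 <= eta z.1 z.2 * q z * q z.
  by move=> zE; rewrite -mulrA -expr2 mulr_ge0 ?sqr_ge0// ltW// ez.
rewrite sumr_ge0// andbT; apply: contra vn0; rewrite psumr_eq0// => /allP qE.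
have [v0 vs] := Vv.
have vE x y : (x, y) \in E -> v x y = in_sum E v x * (eta x y / in_sum E eta x).
  move=> xyE; have exy : 0 < eta x y := ez (x, y) xyE.
  have := qE (x, y); rewrite mem_index_enum xyE => /(_ isT).
  rewrite !mulf_eq0 gt_eqF//= orbb subr_eq0 => /eqP /= qxy.
  by rewrite mulrCA -qxy mulrCA divff ?mulr1// gt_eqF.
have [fp w0 w1 wf] := Tbar_inv_eigen Econ Meta.
pose c := \row_x in_sum E v x.
have cf : c *m Tbar_inv E eta = 1 *: c.
  have [etap _] := fp.
  rewrite scale1r; apply/rowP => y; rewrite mxE (sum_col_edge _ _ etap) [RHS]mxE.
  by apply: eq_bigr => x xyE; rewrite !mxE vE.
have [t ct] : exists t, c = t *: \row_x in_sum E eta x.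
  by apply: (left_eigen_unique Econ fp w0 _ cf); rewrite wf scale1r.
have t0 : t = 0.
  have : \sum_x c ord0 x = 0 by under eq_bigr do rewrite mxE; rewrite sum_in_sum vs.
  by rewrite ct; under eq_bigr do rewrite mxE; rewrite -mulr_sumr w1 mulr1.
have c0 x : in_sum E v x = 0.
  by have := congr1 (fun r : 'rV_d.+1 => r ord0 x) ct; rewrite t0 scale0r !mxE.
apply/eqP/matrixP => x y; rewrite mxE.
have [xyE|/v0//] := boolP ((x, y) \in E).
by rewrite vE// c0 mul0r.
Qed.

Lemma phibar_potential :
  potential_on (coord_image (Wtilde_manifold R E)) (dirs (Wtilde_manifold R E))
    (phibar E).
Proof.
rewrite coord_image_Wtilde//; split; first exact: phibar_smooth.
exact: hessian_phibar_gt0.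
Qed.

End PotentialPhibar.

(** * Nagaoka's structure *)

Section Nagaoka.
Variables (R : realType) (d : nat) (E : {set 'I_d.+1 * 'I_d.+1}).
Hypothesis Econ : strongly_connected E.
Local Notation mx := 'M[R]_d.+1.
Variables (k : nat) (w : 'rV[R]_k -> mx).
Hypothesis w_param : global_parametrization (W_manifold R E) w.

Let W_wf := W_manifold_wf R Econ.
Let A := coord_image (W_manifold R E).
Let V := dirs (W_manifold R E).
Let AV : relatively_open A V := wf_relatively_open W_wf.

(** [eta] expresses the chart in natural parameters, and [tau] is its inverse on [A]. *)
Local Notation eta := (@Tbar R d \o w).
Local Notation tau := (in_coord (W_manifold R E) (pinv setT w)).
Local Notation D i := (natural_field w i).

Let eta_s : smooth_on setT setT eta. Proof. by case: w_param. Qed.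
Let tau_s : smooth_on A V tau. Proof. by case: w_param. Qed.

Let w_mem theta : Wset E (w theta).
Proof. by have [[w_fun _ _] _ _] := w_param; exact: w_fun. Qed.

Let eta_mem theta : A (eta theta).
Proof. by exists (w theta); [exact: w_mem|]. Qed.

Let wK theta : pinv setT w (w theta) = theta.
Proof.
by have [[_ w_inj _] _ _] := w_param; rewrite pinvKV ?inE.
Qed.

Let etaK theta : tau (eta theta) = theta.
Proof.
by have /= -> := in_coordE W_wf (pinv setT w) (w_mem theta); exact: wK.
Qed.

Let tauK x : A x -> eta (tau x) = x.
Proof.
move=> /(coord_imageP W_wf)[p /= Wp [px pE]]; rewrite /= /in_coord /= pE.
have [[_ _ w_surj] _ _] := w_param; have [theta _ wp] := w_surj p Wp.
by rewrite -wp wK wp.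
Qed.

Let D_field i theta : D i (w theta) = partial i eta theta.
Proof. by rewrite /natural_field wK. Qed.

Lemma partial_linear_map (c : mx -> R) (f : 'rV[R]_k -> mx) i theta : linear_map c ->
  smooth_on setT setT f -> partial i (c \o f) theta = c (partial i f theta).
Proof.
move=> c_lin fs; apply: (@derive_val _ _ _ theta).
apply: (is_derive_comp_linear c_lin (linear_mx_continuous c_lin)).
exact: (smooth_on_is_derive fs).
Qed.

Lemma smooth_linear_comp (c : mx -> R) (f : 'rV[R]_k -> mx) : linear_map c ->
  smooth_on setT setT f -> smooth_on setT setT (c \o f).
Proof.
move=> c_lin; apply: (smooth_on_comp_linear (relatively_openT _) c_lin).
exact: linear_mx_continuous.
Qed.

Let Deta_s i : smooth_on setT setT (partial i eta).
Proof. exact: smooth_on_derive. Qed.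

Let frameV : exists n (e : 'I_n -> mx) (kk : 'I_n -> mx -> R), frame V e kk.
Proof.
by apply: frame_exists; [exact: Mset_dirs0|move=> a u v; exact: Mset_dirs_lin].
Qed.

Let frameT : exists n (e : 'I_n -> 'rV[R]_k) (kk : 'I_n -> 'rV[R]_k -> R),
  frame setT e kk.
Proof. exact: frame_exists. Qed.

Lemma line_velocity_mem (f : 'rV[R]_k -> mx) i theta : smooth_on setT setT f ->
  (forall t t', V (f t - f t')) -> V (partial i f theta).
Proof.
move=> fs fV; have [n [e [kk ek]]] := frameV.
have /is_derive_line fd : is_derive theta (delta_mx ord0 i) f (partial i f theta).
  exact: (smooth_on_is_derive fs).
by apply: (velocity_mem AV ek _ fd); near=> h; exact: fV.
Unshelve. all: by end_near. Qed.

Let Deta_mem i theta : V (partial i eta theta).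
Proof.
apply: (line_velocity_mem i theta eta_s) => t t'; have [_ _ A_sub _] := W_wf.
by apply: A_sub; exact: eta_mem.
Qed.

Let DDeta_mem i j theta : V (partial i (partial j eta) theta).
Proof.
apply: (line_velocity_mem i theta (Deta_s j)) => t t'.
by apply: (dirs_sub AV); exact: Deta_mem.
Qed.

(** Differentiate tau (eta theta) = theta. Since [tau] is controlled only on [A] in the directions
    [V], the chain rule is used along the curve [c], which stays in [A], for one coordinate of [tau]
    at a time. *)
Let tau_Deta i theta : 'D_(partial i eta theta) tau (eta theta) = delta_mx ord0 i.
Proof.
have [n [e [kk ek]]] := frameT; have [n' [e' [kk' ek']]] := frameV.
have /is_derive_line ed : is_derive theta (delta_mx ord0 i) eta (partial i eta theta).
  exact: (smooth_on_is_derive eta_s).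
set c := fun h : R => eta (theta + h *: delta_mx ord0 i) in ed.
have c0 : c 0 = eta theta by rewrite /c scale0r addr0.
apply: (frame_inj ek) => // j.
have kts : smooth_on A V (kk j \o tau).
  apply: (smooth_on_comp_linear AV (frame_lin ek j)) => //; exact: (frame_cont ek).
have -> : kk j ('D_(partial i eta theta) tau (eta theta)) =
    'D_(partial i eta theta) (kk j \o tau) (eta theta).
  apply/esym/(@derive_val _ _ _ (eta theta)).
  apply: (is_derive_comp_linear (frame_lin ek j)); first exact: (frame_cont ek).
  exact: (smooth_on_is_derive tau_s).
have Vc : \forall h \near (0 : R), V (c h - c 0).
  by near=> h; have [_ _ A_sub _] := W_wf; apply: A_sub; exact: eta_mem.
have Ac : A (c 0) by exact: eta_mem.
have := chain_curve AV ek' kts Ac Vc ed; rewrite c0 => -[_ <-].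
have -> : (kk j \o tau) \o c = fun h : R => kk j (theta + h *: delta_mx ord0 i).
  by apply/funext => h; rewrite [LHS]/= etaK.
have kd : is_derive theta (delta_mx ord0 i) (kk j) (kk j (delta_mx ord0 i)) :=
  is_derive_comp_linear (frame_lin ek j) (frame_cont ek (i := j))
    (is_derive_id theta (delta_mx ord0 i)).
by have /is_derive_line[_ ->] := kd.
Unshelve. all: by end_near. Qed.

(** The dictionary between derivatives on the slice and partial derivatives in the natural
    parameters. *)
Lemma derive_comp_tau (f : 'rV[R]_k -> R) i theta : smooth_on setT setT f ->
  'D_(partial i eta theta) (f \o tau) (eta theta) = partial i f theta.
Proof.
move=> fs; have [n [e [kk ek]]] := frameT.
have td := smooth_on_is_derive tau_s (eta_mem theta) (Deta_mem i theta).
have [_ ->] := is_derive_comp ek fs td.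
by rewrite tau_Deta etaK.
Qed.

Lemma natural_field_coord_field i : coord_field A V (in_coord (W_manifold R E) (D i)).
Proof.
have [n [e [kk ek]]] := frameV; have [n' [e' [kk' ek']]] := frameT.
apply: (eq_on_coord_field AV (F := fun x => \sum_j (kk j \o partial i eta \o tau) x *: e j)).
  move=> x Ax; rewrite -(frame_decomp ek) //; exact: Deta_mem.
apply: (coord_field_comb AV ek) => j.
exact: (smooth_on_comp AV ek' tau_s (smooth_linear_comp (frame_lin ek j) (Deta_s i))).
Qed.

Lemma derive_natural_field i j theta :
  'D_(partial i eta theta) (in_coord (W_manifold R E) (D j)) (eta theta) =
  partial i (partial j eta) theta.
Proof.
have [n [e [kk ek]]] := frameV.
have cD := natural_field_coord_field j.
have VD := Deta_mem i theta; have Ae := eta_mem theta.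
apply: (frame_inj ek (derive_field_mem AV ek cD Ae VD) (DDeta_mem i j theta)) => l.
apply: etrans (derive_field_coord ek l cD Ae VD) _.
apply: etrans _ (partial_linear_map i theta (frame_lin ek l) (Deta_s j)).
exact: (derive_comp_tau i theta (smooth_linear_comp (frame_lin ek l) (Deta_s j))).
Qed.

Let A_Mset : A = Mset E. Proof. exact: coord_image_W. Qed.

Let eta_Mset theta : Mset E (eta theta). Proof. by rewrite -A_Mset. Qed.

Definition log_w_derivative i theta x y :=
  partial i eta theta x y / eta theta x y -
  in_sum E (partial i eta theta) x / in_sum E (eta theta) x.

Lemma log_wE x y : (x, y) \in E -> (fun theta => ln (w theta x y)) =
  (fun theta => ln (eta theta x y) - ln (in_sum E (eta theta) x)).
Proof.
move=> xyE; apply/funext => theta; have [Meta _] := eta_Mset theta.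
rewrite -[in LHS](TbarK Econ (Wset_Wtilde Econ (w_mem theta))) mxE ln_div//.
  by rewrite posrE; exact: (Mtilde_edge Meta xyE).
by rewrite posrE; exact: (Mtilde_in_sum Econ x Meta).
Qed.

Lemma log_w_smooth x y : (x, y) \in E ->
  smooth_on setT setT (fun theta => ln (w theta x y)).
Proof.
move=> xyE; rewrite log_wE//; have AT := relatively_openT 'rV[R]_k.
have M theta : Mtilde E (eta theta) by have [] := eta_Mset theta.
apply: (smooth_on_sub AT); apply: (smooth_on_ln AT).
- exact: (smooth_linear_comp (@entry_lin R d x y) eta_s).
- by move=> theta _; exact: (Mtilde_edge (M theta) xyE).
- exact: (smooth_linear_comp (@in_sum_lin R d E x) eta_s).
by move=> theta _; exact: (Mtilde_in_sum Econ x (M theta)).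
Qed.

Lemma partial_log_w i theta x y : (x, y) \in E ->
  partial i (fun theta => ln (w theta x y)) theta = log_w_derivative i theta x y.
Proof.
move=> xyE; rewrite log_wE//; have [M _] := eta_Mset theta.
have etad := smooth_on_is_derive eta_s (I : setT theta) (I : setT (delta_mx ord0 i)).
have lind (c : mx -> R) : linear_map c ->
    is_derive theta (delta_mx ord0 i) (c \o eta) (c (partial i eta theta)).
  move=> c_lin; apply: (is_derive_comp_linear c_lin) => //.
  exact: linear_mx_continuous.
apply: (@derive_val _ _ _ theta); apply: is_deriveB; apply: is_derive_ln.
- exact: (Mtilde_edge M xyE).
- exact: (lind _ (@entry_lin R d x y)).
- exact: (Mtilde_in_sum Econ x M).
exact: (lind _ (@in_sum_lin R d E x)).
Qed.

Lemma pair_distE x y :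
  (fun theta => pair_dist (w theta) x y) = (fun theta => eta theta x y).
Proof. by apply/funext => theta; rewrite /= mxE. Qed.

(* On [Mset] the marginal equations eliminate the second correction term of the
   Hessian. *)
Lemma hessian_phibar_Mset x u v : Mset E x -> Mset_dirs E u -> Mset_dirs E v ->
  hessian (@phibar R d E) x u v = \sum_(z in E)
    (u z.1 z.2 / x z.1 z.2 - in_sum E u z.1 / in_sum E x z.1) * v z.1 z.2.
Proof.
move=> [M xio] [Vu uio] [Vv vio]; rewrite hessian_phibar//.
pose I y := in_sum E u y / in_sum E x y; pose J y := in_sum E v y / in_sum E x y.
have J0 : \sum_(z in E) (u z.1 z.2 - x z.1 z.2 * I z.1) * J z.1 = 0.
  rewrite (sum_edges_out E (fun a b => (u a b - x a b * I a) * J a)).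
  apply: big1 => a _; rewrite -mulr_suml sumrB -mulr_suml.
  rewrite -/(out_sum E u a) -/(out_sum E x a) uio xio /I.
  have ix : in_sum E x a != 0 by rewrite gt_eqF// (Mtilde_in_sum Econ a M).
  by rewrite [in_sum E x a * _]mulrC divfK// subrr mul0r.
rewrite -[RHS]subr0 -[X in _ = _ - X]J0 -sumrB; apply: eq_bigr => z zE.
rewrite -/(I z.1) -/(J z.1).
have : 0 < x z.1 z.2 by apply: (Mtilde_edge M); rewrite -surjective_pairing.
move: (I z.1) (J z.1) (x z.1 z.2) => i j t t0.
by field; rewrite gt_eqF.
Qed.

Lemma nagaoka_hessian_structure n (e : 'I_n -> mx) (kk : 'I_n -> mx -> R) :
  frame V e kk ->
  is_nagaoka E w (hessian_structure (W_manifold R E) e (phibar E)).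
Proof.
move=> ek.
have phi_pot : potential_on A V (phibar E).
  exact: (potential_on_submanifold (W_submanifold R Econ) (phibar_potential R Econ)).
have DE i theta : D i (w theta) = partial i eta theta by exact: D_field.
have edge (z : 'I_d.+1 * 'I_d.+1) : z \in E -> (z.1, z.2) \in E.
  by rewrite -surjective_pairing.
split=> theta i j.
- have [M _] := eta_Mset theta; rewrite /= !DE hessian_phibar//.
  + apply: eq_bigr => z zE; rewrite !partial_log_w; try exact: edge.
    by rewrite -[pair_dist _ _ _]/((fun t => pair_dist (w t) z.1 z.2) theta) pair_distE.
  + by have [] := Deta_mem i theta.
  + by have [] := Deta_mem j theta.
- move=> l; rewrite /= !DE hessian_hess /conn_of /= !DE.
  have Ve := dual_operator_mem AV ek (phibar E).
  have cD := natural_field_coord_field j.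
  have Ae := eta_mem theta; have VD := Deta_mem i theta; have VDl := Deta_mem l theta.
  rewrite (hess_sym AV phi_pot Ae (Ve _ _ _) VDl).
  rewrite (dual_operatorP AV ek phi_pot cD Ae VD VDl).
  (* The vector [partial l eta theta] stays frozen at [theta], as [covector] takes a constant
     direction; differentiating [f] therefore acts on the logarithms only, as in the formula for the
     e-connection. *)
  pose f t := \sum_(z in E) partial j (fun t => ln (w t z.1 z.2)) t *
    partial l eta theta z.1 z.2.
  have AT := relatively_openT 'rV[R]_k.
  have ps z : z \in E -> smooth_on setT setT (partial j (fun t => ln (w t z.1 z.2))).
    by move=> zE; apply: smooth_on_derive => //; apply: log_w_smooth; exact: edge.
  have fs : smooth_on setT setT f.
    apply: (smooth_on_sum AT) => z zE; apply: (smooth_on_mul AT); first exact: ps.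
    exact: (smooth_on_cst AT).
  have covE x : A x -> covector (phibar E) (partial l eta theta)
      (in_coord (W_manifold R E) (D j)) x = (f \o tau) x.
    move=> Ax; have VDx : V (in_coord (W_manifold R E) (D j) x).
      exact: Deta_mem j (tau x).
    rewrite /covector (hess_sym AV phi_pot Ax VDl VDx).
    have Mx : Mset E x by rewrite -A_Mset.
    rewrite -hessian_hess (hessian_phibar_Mset Mx VDx VDl).
    apply: eq_bigr => z zE; rewrite partial_log_w; last exact: edge.
    by rewrite /log_w_derivative tauK.
  rewrite (eq_on_derive AV covE Ae VD) derive_comp_tau//.
  apply: (@derive_val _ _ _ theta); apply: is_derive_bigsum => z zE.
  rewrite pair_distE (partial_linear_map l theta (@entry_lin R d z.1 z.2) eta_s).
  have pd := smooth_on_is_derive (ps z zE) (I : setT theta) (I : setT (delta_mx ord0 i)).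
  apply: (is_derive_comp_linear (c := fun s : R => s * _) _ _ pd) => [a s t|s].
    by rewrite mulrDl -mulrA.
  by apply: cvgMl; exact: cvg_id.
move=> l; rewrite /= !DE /conn_of /= !DE derive_natural_field hessian_hess.
have Ae := eta_mem theta.
(* [hessian_phibar_Mset] is asymmetric in form: its first argument appears as a derivative of log w,
   its second as a derivative of the pair distribution. The m-connection formula needs index [l] in
   the first place. *)
rewrite (hess_sym AV phi_pot Ae (DDeta_mem i j theta) (Deta_mem l theta)) -hessian_hess.
rewrite hessian_phibar_Mset//; [|exact: Deta_mem|exact: DDeta_mem].
apply: eq_bigr => z zE; rewrite mulrC partial_log_w; last exact: edge.
congr (_ * _); rewrite pair_distE.
have pE : partial j (fun t => eta t z.1 z.2) =
    fun t => partial j eta t z.1 z.2.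
  by apply/funext => t; exact: (partial_linear_map j t (@entry_lin R d z.1 z.2) eta_s).
rewrite pE.
by rewrite (partial_linear_map i theta (@entry_lin R d z.1 z.2) (Deta_s j)).
Qed.

End Nagaoka.

Theorem theorem3p7 (R : realType) (d : nat) (E : {set 'I_d.+1 * 'I_d.+1})
    (d_ge1 : (1 <= d)%N) (E_connected : strongly_connected E) :
  [/\ set_bij (Wtilde E) (Mtilde E) (@Tbar R d),
      set_bij (Wset E) (Mset E) (@Tbar R d),
      (exists s : dual_structure 'M[R]_d.+1 'M[R]_d.+1,
         [/\ induced_by_potential (Wtilde_manifold R E) (phibar E) s,
             dually_flat (Wtilde_manifold R E) s &
             exists s' : dual_structure 'M[R]_d.+1 'M[R]_d.+1,
               [/\ restriction (Wtilde_manifold R E) (W_manifold R E) s s',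
                   dually_flat (W_manifold R E) s' &
                   forall (k : nat) (F : 'I_k -> 'M[R]_d.+1)
                     (w : 'rV[R]_k -> 'M[R]_d.+1),
                     quotient_basis E F -> natural_parametrization E F w ->
                     is_nagaoka E w s']]) &
      (forall F : R -> R, standard_convex F ->
         forall f g : 'M[R]_d.+1, Wtilde E f -> Wtilde E g ->
           F_divergence E F f g =
           \sum_(e in E) mu f ord0 e.1 * f e.1 e.2 * F (g e.1 e.2 / f e.1 e.2))].
Proof.
split; [exact: Tbar_bij|exact: Tbar_Wset_bij| |]; last first.
  move=> F _ f g [_ f1] [_ g1]; apply: eq_bigr => z _.
  by rewrite f1 g1 !divr1.
have wf := Wtilde_manifold_wf R E_connected.
have wf' := W_manifold_wf R E_connected.
have sub := W_submanifold R E_connected.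
have pot := phibar_potential R E_connected.
have pot' := potential_on_submanifold sub pot.
have [n [e [k ek]]] : exists n (e : 'I_n -> 'M[R]_d.+1) k,
    frame (dirs (Wtilde_manifold R E)) e k.
  by apply: frame_exists; [exact: Mtilde_dirs0|exact: Mtilde_dirs_lin].
have [n' [e' [k' ek']]] : exists n (e : 'I_n -> 'M[R]_d.+1) k,
    frame (dirs (W_manifold R E)) e k.
  by apply: frame_exists; [exact: Mset_dirs0|exact: Mset_dirs_lin].
have [ind flat] := hessian_structureP wf ek pot.
have [_ flat'] := hessian_structureP wf' ek' pot'.
exists (hessian_structure (Wtilde_manifold R E) e (phibar E)).
split; [exact: ind|exact: flat|].
exists (hessian_structure (W_manifold R E) e' (phibar E)).
split; [exact: (hessian_restriction wf wf' sub ek ek' pot)|exact: flat'|].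
by move=> j F w _ [w_param _]; exact: (nagaoka_hessian_structure E_connected w_param ek').
Qed.
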